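(* Let $\mathfrak{M}$ be the monotone $C^*$-algebra acting on the monotone Fock space $\mathcal{F}_m$, let $\omega$ be the vacuum state and $\omega_\infty$ the state at infinity on $\mathfrak{M}$, and let $P_\zeta$ be the orthogonal projection of $\mathcal{F}_m$ onto $\mathbb{C}\zeta$, with $P_\zeta^\perp=I-P_\zeta$. Let $\varphi=\gamma\omega+(1-\gamma)\omega_\infty$ with $0\le\gamma\le 1$, and let $\xi_\varphi^\perp$ be the tail algebra of the stochastic process corresponding to $\varphi$. Then: (1) if $\gamma=0$, i.e. $\varphi=\omega_\infty$, then $\pi_{\omega_\infty}(\mathfrak{M})''=\mathbb{C}=\xi_{\omega_\infty}^\perp$; (2) if $\gamma=1$, i.e. $\varphi=\omega$, then $\pi_\omega(\mathfrak{M})''=\mathcal{B}(\mathcal{F}_m)$ and $\xi_\omega^\perp=\mathbb{C}P_\zeta\oplus\mathbb{C}P_\zeta^\perp$; (3) if $0<\gamma<1$, then $\pi_\varphi(\mathfrak{M})''=\mathcal{B}(\mathcal{F}_m)\oplus\mathbb{C}$ and $\xi_\varphi^\perp=(\mathbb{C}P_\zeta\oplus\mathbb{C}P_\zeta^\perp)\oplus\mathbb{C}$.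
   Context: Monotone $C^*$-algebra. For $k\ge 1$ let $I_k=\{(i_1,\dots,i_k)\in\mathbb{Z}^k: i_1<\dots<i_k\}$. The discrete monotone Fock space is $\mathcal{F}_m=\bigoplus_{k\ge 0}\mathcal{H}_k$ with $\mathcal{H}_k=\ell^2(I_k)$ for $k\geq 1$ and $\mathcal{H}_0=\mathbb{C}\zeta$, $\zeta$ a unit vector (the vacuum); its canonical orthonormal basis is $\{\zeta\}\cup\{e_{(i_1,\dots,i_k)}\}$. For $i\in\mathbb{Z}$ the creation operator $a_i^\dagger$ is the bounded operator with $a_i^\dagger\zeta=e_{(i)}$ and $a_i^\dagger e_{(i_1,\dots,i_k)}=e_{(i,i_1,\dots,i_k)}$ if $i<i_1$, and $0$ otherwise. The annihilation operator $a_i$ is its adjoint: $a_i\zeta=0$, $a_ie_{(i_1,\dots,i_k)}=e_{(i_2,\dots,i_k)}$ if $i=i_1$ (with $a_ie_{(i)}=\zeta$), and $0$ otherwise. $\mathfrak{M}\subset\mathcal{B}(\mathcal{F}_m)$ is the unital $C^*$-algebra generated by $\{a_i:i\in\mathbb{Z}\}$. States. The vacuum state is $\omega(Y)=\langle Y\zeta,\zeta\rangle$. A $\lambda$-form is a word $a_{i_1}^\dagger\cdots a_{i_m}^\dagger a_{j_1}\cdots a_{j_n}$ with $i_1<\dots<i_m$, $j_1>\dots>j_n$, $m,n\ge0$ (length $m+n$); a $\pi$-form is a word $a_{i_1}^\dagger\cdots a_{i_m}^\dagger a_ka_k^\dagger a_{j_1}\cdots a_{j_n}$ with $i_1<\dots<i_m<k>j_1>\dots>j_n$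 (length $m+n+2$). Let $\mathfrak{B}$ be the norm closure of the linear span of all $\lambda$-forms and $\pi$-forms of strictly positive length. It is known that every $Y\in\mathfrak{M}$ is uniquely $Y=X+cI$ with $X\in\mathfrak{B}$, $c\in\mathbb{C}$, and the state at infinity is $\omega_\infty(X+cI):=c$. (The convex combinations $\gamma\omega+(1-\gamma)\omega_\infty$ are exactly the symmetric states of $\mathfrak{M}$, i.e. those corresponding to exchangeable monotone processes.) GNS representations. $(\mathcal{H}_\varphi,\pi_\varphi,\xi_\varphi)$ denotes the GNS triple of $\varphi$, with the following identifications up to unitary equivalence: for $\varphi=\omega$ it is $\mathcal{F}_m$ with the identity representation and vector $\zeta$; for $\varphi=\omega_\infty$ it is $\mathbb{C}$ with $\pi_{\omega_\infty}=\omega_\infty$; for $0<\gamma<1$ it is $\mathcal{H}_\varphi=\mathcal{F}_m\oplus\mathbb{C}$, $\pi_\varphi(X)=X\oplus\omega_\infty(X)$, $\xi_\varphi=\gamma^{1/2}\zeta\oplus(1-\gamma)^{1/2}$. Process of a state. The process corresponding to $\varphi$ has sample algebra $\mathfrak{A}=\mathbb{M}_2(\mathbb{C})\oplus\mathbb{C}$ and unital $*$-homomorphisms $\iota_j:\mathfrak{A}\to\mathcal{B}(\mathcal{H}_\varphi)$, $j\in\mathbb{Z}$, given for $(\alpha_{r,s})\in\mathbb{M}_2(\mathbb{C})$, $\beta\in\mathbb{C}$ by $$\iota_j\big((\alpha_{r,s})\oplus\beta\big)=\pi_\varphi\Big(\alpha_{1,1}a_ja_j^\dagger+\alpha_{1,2}a_j+\alpha_{2,1}a_j^\dagger+\alpha_{2,2}a_j^\dagger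 a_j+\beta\sum_{k<j}a_k^\dagger a_k\Big),$$ where $\sum_{k<j}a_k^\dagger a_k$ converges strongly and equals $I-a_ja_j^\dagger-a_j^\dagger a_j\in\mathfrak{M}$. Tail algebra. With $\bigvee$ denoting the von Neumann algebra generated, $$\xi_\varphi^\perp:=\bigcap_{I\subset\mathbb{Z},\ I\text{ finite}}\Big(\bigcup_{K\cap I=\emptyset,\ K\text{ finite}}\Big(\bigvee_{k\in K}\iota_k(\mathfrak{A})\Big)\Big)''.$$ $\mathbb{C}P_\zeta\oplus\mathbb{C}P_\zeta^\perp$ denotes the two-dimensional algebra $\{\lambda P_\zeta+\mu P_\zeta^\perp:\lambda,\mu\in\mathbb{C}\}$. *)

(* Defs.v *)
From HB Require Import structures.
From mathcomp Require Import all_boot all_order all_algebra.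
From mathcomp Require Import sesquilinear complex finmap.
From mathcomp Require Import boolp classical_sets functions cardinality fsbigop.
From mathcomp Require Import reals ereal topology normedtype sequences esum.
From mathcomp Require Import numfun realfun ring lra.
Set Implicit Arguments.
Unset Strict Implicit.
Unset Printing Implicit Defensive.
Import Order.TTheory GRing.Theory Num.Theory numFieldNormedType.Exports.
Local Open Scope classical_set_scope.
Local Open Scope ring_scope.
Local Notation Re := complex.Re.
Local Notation Im := complex.Im.

Section summation.
Variables (R : realType) (J : choiceType).
Implicit Types f g : J -> R.

Definition rsummable f := summable [set: J] (EFin \o f).

(* [esum] is meant for nonnegative families, hence the positive and negative
   parts. *)
Definition rsum f : R :=
  fine (\esum_(j in [set: J]) (EFin \o f)^\+ j
        - \esum_(j in [set: J]) (EFin \o f)^\- j)%E.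

Lemma rsummable_ge0 f : (forall j, 0 <= f j) ->
  rsummable f <-> (\esum_(j in [set: J]) (f j)%:E < +oo)%E.
Proof.
move=> f0; rewrite /rsummable /summable.
have -> : \esum_(x in [set: J]) `|(EFin \o f) x|%E =
  \esum_(x in [set: J]) (f x)%:E; last by [].
by apply: eq_esum => j _ /=; rewrite ger0_norm.
Qed.

Lemma esum_fin f : (forall j, 0 <= f j) -> rsummable f ->
  (\esum_(j in [set: J]) (f j)%:E)%E \is a fin_num.
Proof.
move=> f0 /(rsummable_ge0 f0) sf; rewrite ge0_fin_numE//.
by apply: esum_ge0 => j _; rewrite lee_fin.
Qed.

Lemma rsummable_le f g : (forall j, `|f j| <= g j) -> rsummable g ->
  rsummable f.
Proof.
move=> fg; apply: le_lt_trans; apply: le_esum => j _ /=.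
by rewrite lee_fin (le_trans (fg j))// ler_norm.
Qed.

Lemma rsummableD f g : rsummable f -> rsummable g ->
  rsummable (fun j => f j + g j).
Proof. by move=> sf sg; apply: (summableD sf sg). Qed.

Lemma esumZ_le (c : R) f : 0 < c -> (forall j, 0 <= f j) ->
  (\esum_(j in [set: J]) (c * f j)%:E
    <= c%:E * \esum_(j in [set: J]) (f j)%:E)%E.
Proof.
move=> c0 f0; apply: ge_ereal_sup => _ [A [fA _] <-].
have -> : (\sum_(x \in A) (c * f x)%:E = c%:E * \sum_(x \in A) (f x)%:E)%E.
  by rewrite ge0_mule_fsumr// => j; rewrite lee_fin.
rewrite lee_pmul2l//; apply: ereal_sup_ubound; exists A => //.
Qed.

Lemma esumZ (c : R) f : 0 <= c -> (forall j, 0 <= f j) ->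
  (\esum_(j in [set: J]) (c * f j)%:E
    = c%:E * \esum_(j in [set: J]) (f j)%:E)%E.
Proof.
rewrite le_eqVlt => /predU1P[<- _|c0 f0].
  by rewrite mul0e esum1// => j _; rewrite mul0r.
apply/eqP; rewrite eq_le esumZ_le//=.
rewrite -lee_pdivlMl//.
apply: le_trans (esumZ_le _ _); rewrite ?invr_gt0//.
- by apply: le_esum => j _; rewrite lee_fin mulrA mulVf ?gt_eqF// mul1r.
- by move=> j; rewrite mulr_ge0// ltW.
Qed.

Lemma rsummable_norm f : rsummable f -> rsummable (fun j => `|f j|).
Proof.
by apply: le_lt_trans; apply: le_esum => j _ /=; rewrite lee_fin normr_id.
Qed.

Lemma rsummableZ (c : R) f : rsummable f -> rsummable (fun j => c * f j).
Proof.
move=> /rsummable_norm sf.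
apply: (@rsummable_le _ (fun j => `|c| * `|f j|)) => [j|].
  by rewrite normrM.
apply/rsummable_ge0 => [j|]; first by rewrite mulr_ge0.
rewrite esumZ// lte_mul_pinfty// ?lee_fin//.
by move/rsummable_ge0: sf; apply => j.
Qed.

Lemma rsumB f g : (forall j, 0 <= f j) -> (forall j, 0 <= g j) ->
  rsummable f -> rsummable g ->
  rsum (fun j => f j - g j) =
  fine (\esum_(j in [set: J]) (f j)%:E) - fine (\esum_(j in [set: J]) (g j)%:E).
Proof.
move=> f0 g0 sf sg; rewrite -fineB ?esum_fin//; congr fine.
by apply: (esumB sf sg) => j _; rewrite lee_fin.
Qed.

Lemma rsum_ge0 f : (forall j, 0 <= f j) -> rsummable f ->
  rsum f = fine (\esum_(j in [set: J]) (f j)%:E).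
Proof.
move=> f0 sf.
have s0 : rsummable (fun=> 0) by apply/rsummable_ge0 => //; rewrite esum1.
have -> : rsum f = rsum (fun j => f j - 0).
  by congr rsum; apply/funext => j; rewrite subr0.
by rewrite rsumB// [X in _ - fine X]esum1// subr0.
Qed.

Let pos f j := Num.max (f j) 0.
Let neg f j := Num.max (- f j) 0.

Let posneg f j : f j = pos f j - neg f j.
Proof.
by rewrite /pos /neg; case: (ltrP (f j) 0); case: (ltrP (- f j) 0); lra.
Qed.

Let pos_ge0 f j : 0 <= pos f j. Proof. by rewrite le_max lexx orbT. Qed.
Let neg_ge0 f j : 0 <= neg f j. Proof. by rewrite le_max lexx orbT. Qed.

Let spos f : rsummable f -> rsummable (pos f).
Proof.
move=> /rsummable_norm; apply: rsummable_le => j.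
by rewrite ger0_norm// ge_max ler_norm/=.
Qed.

Let sneg f : rsummable f -> rsummable (neg f).
Proof.
move=> /rsummable_norm; apply: rsummable_le => j.
by rewrite ger0_norm// ge_max -normrN ler_norm/=.
Qed.

Let fine_esumD f g : (forall j, 0 <= f j) -> (forall j, 0 <= g j) ->
  rsummable f -> rsummable g ->
  fine (\esum_(j in [set: J]) (f j + g j)%:E) =
  fine (\esum_(j in [set: J]) (f j)%:E) + fine (\esum_(j in [set: J]) (g j)%:E).
Proof.
move=> f0 g0 sf sg; rewrite -fineD ?esum_fin//; congr fine.
by rewrite -esumD// => j _; rewrite lee_fin.
Qed.

Let rsumE f : rsummable f -> rsum f =
  fine (\esum_(j in [set: J]) (pos f j)%:E)
  - fine (\esum_(j in [set: J]) (neg f j)%:E).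
Proof.
move=> sf; rewrite -(rsumB (pos_ge0 f) (neg_ge0 f) (spos sf) (sneg sf)).
by congr rsum; apply/funext => j; rewrite -posneg.
Qed.

Lemma rsumD f g : rsummable f -> rsummable g ->
  rsum (fun j => f j + g j) = rsum f + rsum g.
Proof.
move=> sf sg.
have -> : (fun j => f j + g j) =
    (fun j => (pos f j + pos g j) - (neg f j + neg g j)).
  by apply/funext => j; rewrite (posneg f) (posneg g); lra.
rewrite (@rsumB (fun j => pos f j + pos g j) (fun j => neg f j + neg g j)).
- rewrite (fine_esumD (pos_ge0 f) (pos_ge0 g) (spos sf) (spos sg)).
  rewrite (fine_esumD (neg_ge0 f) (neg_ge0 g) (sneg sf) (sneg sg)).
  by rewrite (rsumE sf) (rsumE sg); lra.
- by move=> j; rewrite addr_ge0.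
- by move=> j; rewrite addr_ge0.
- exact: rsummableD (spos sf) (spos sg).
- exact: rsummableD (sneg sf) (sneg sg).
Qed.

Lemma rsumN f : rsummable f -> rsum (fun j => - f j) = - rsum f.
Proof.
move=> sf.
have -> : (fun j => - f j) = (fun j => neg f j - pos f j).
  by apply/funext => j; rewrite [in LHS]posneg opprB.
rewrite (rsumB (neg_ge0 f) (pos_ge0 f) (sneg sf) (spos sf)) (rsumE sf).
by rewrite opprB.
Qed.

Let rsumZ_ge0 (c : R) f : 0 <= c -> rsummable f ->
  rsum (fun j => c * f j) = c * rsum f.
Proof.
move=> c0 sf.
have -> : (fun j => c * f j) = (fun j => c * pos f j - c * neg f j).
  by apply/funext => j; rewrite [in LHS]posneg mulrBr.
rewrite (@rsumB (fun j => c * pos f j) (fun j => c * neg f j)).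
- rewrite (esumZ c0 (pos_ge0 f)) (esumZ c0 (neg_ge0 f)) !fineM//.
  + by rewrite (rsumE sf) mulrBr.
  + by apply: esum_fin => //; exact: sneg.
  + by apply: esum_fin => //; exact: spos.
- by move=> j; rewrite mulr_ge0.
- by move=> j; rewrite mulr_ge0.
- exact: rsummableZ (spos sf).
- exact: rsummableZ (sneg sf).
Qed.

Lemma rsumZ (c : R) f : rsummable f -> rsum (fun j => c * f j) = c * rsum f.
Proof.
move=> sf; have [c0|c0] := leP 0 c; first exact: rsumZ_ge0.
have -> : (fun j => c * f j) = (fun j => - (- c * f j)).
  by apply/funext => j; lra.
rewrite rsumN; last exact: rsummableZ.
by rewrite rsumZ_ge0 ?oppr_ge0 ?ltW//; lra.
Qed.

Lemma rsum_ge f j : (forall j, 0 <= f j) -> rsummable f -> f j <= rsum f.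
Proof.
move=> f0 sf; rewrite rsum_ge0// -lee_fin fineK ?esum_fin//.
by apply: esum_ge; exists [set j]; [split|rewrite fsbig_set1].
Qed.

End summation.

Definition sqmod (R : realType) (z : R[i]) : R := Re z ^+ 2 + Im z ^+ 2.

Section complex_summation.
Variables (R : realType) (J : choiceType).
Implicit Types f g : J -> R[i].

Definition csummable f :=
  rsummable (fun j => Re (f j)) /\ rsummable (fun j => Im (f j)).

Definition csum f : R[i] :=
  (rsum (fun j => Re (f j)) +i* rsum (fun j => Im (f j)))%C.

Lemma csumD f g : csummable f -> csummable g ->
  csum (fun j => f j + g j) = csum f + csum g.
Proof.
move=> [fR fI] [gR gI]; apply/eqP; rewrite eq_complex /csum /=.
apply/andP; split; apply/eqP.
- by rewrite -rsumD//; congr rsum; apply/funext => j; case: (f j); case: (g j).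
- by rewrite -rsumD//; congr rsum; apply/funext => j; case: (f j); case: (g j).
Qed.

Lemma csummableZ (c : R[i]) f : csummable f -> csummable (fun j => c * f j).
Proof.
move=> [fR fI]; case: c => a b; split.
- have := rsummableD (rsummableZ a fR) (rsummableZ (- b) fI).
  by congr rsummable; apply/funext => j; case: (f j) => x y /=; lra.
- have := rsummableD (rsummableZ a fI) (rsummableZ b fR).
  by congr rsummable; apply/funext => j; case: (f j) => x y /=; lra.
Qed.

Lemma csumZ (c : R[i]) f : csummable f -> csum (fun j => c * f j) = c * csum f.
Proof.
move=> [fR fI]; case: c => a b; apply/eqP; rewrite eq_complex /csum /=.
have -> : (fun j => Re ((a +i* b)%C * f j)) =
    (fun j => a * Re (f j) + - b * Im (f j)).
  by apply/funext => j; case: (f j) => x y /=; lra.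
have -> : (fun j => Im ((a +i* b)%C * f j)) =
    (fun j => a * Im (f j) + b * Re (f j)).
  by apply/funext => j; case: (f j) => x y /=; lra.
rewrite !rsumD; try exact: rsummableZ.
rewrite !rsumZ//; apply/andP; split; apply/eqP; lra.
Qed.

Lemma csum_conj f : csummable f ->
  csum (fun j => Num.conj (f j)) = Num.conj (csum f).
Proof.
move=> [fR fI]; apply/eqP; rewrite eq_complex /csum /=.
apply/andP; split; apply/eqP.
- by congr rsum; apply/funext => j; case: (f j).
- by rewrite -rsumN//; congr rsum; apply/funext => j; case: (f j).
Qed.

End complex_summation.

Section l2.
Variables (R : realType) (J : choiceType).

Definition square_summable : {pred J -> R[i]} :=
  fun f => `[< (\esum_(j in [set: J]) (sqmod (f j))%:E < +oo)%E >].

Record l2 : Type := L2 { l2val :> J -> R[i]; _ : l2val \in square_summable }.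

HB.instance Definition _ := [isSub for l2val].
HB.instance Definition _ := [Choice of l2 by <:].

Lemma sqmod_ge0 (z : R[i]) : 0 <= sqmod z.
Proof. by rewrite addr_ge0// sqr_ge0. Qed.

Lemma square_summableP (f : J -> R[i]) :
  reflect (rsummable (fun j => sqmod (f j))) (f \in square_summable).
Proof.
have H := @rsummable_ge0 R J (fun j => sqmod (f j)) (fun j => sqmod_ge0 (f j)).
by apply: (iffP (asboolP _)) => [/(proj2 H)|/(proj1 H)].
Qed.

Fact square_summable_submod : submod_closed square_summable.
Proof.
split=> [|c f g /square_summableP sf /square_summableP sg].
  apply/square_summableP/rsummable_ge0 => [j|]; first exact: sqmod_ge0.
  by rewrite esum1// => j _; rewrite /sqmod /= expr0n /= addr0.
apply/square_summableP.
have := rsummableZ 2 (rsummableD (rsummableZ (sqmod c) sf) sg).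
apply: rsummable_le => j; rewrite ger0_norm ?sqmod_ge0//.
rewrite /sqmod /=; change ((c *: f + g) j) with (c * f j + g j).
case: c (f j) (g j) => a b [x y] [z t] /=.
rewrite -subr_ge0.
have -> : 2 * ((a ^+ 2 + b ^+ 2) * (x ^+ 2 + y ^+ 2) + (z ^+ 2 + t ^+ 2)) -
  ((a * x - b * y + z) ^+ 2 + (a * y + b * x + t) ^+ 2)
  = (a * x - b * y - z) ^+ 2 + (a * y + b * x - t) ^+ 2 by ring.
by rewrite addr_ge0// sqr_ge0.
Qed.

HB.instance Definition _ :=
  GRing.isSubmodClosed.Build R[i] (J -> R[i]) square_summable
    square_summable_submod.
HB.instance Definition _ := [SubChoice_isSubLmodule of l2 by <:].

Definition l2dot (f g : l2) : R[i] := csum (fun j => f j * Num.conj (g j)).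

Lemma l2P (f : l2) : rsummable (fun j => sqmod (f j)).
Proof. by apply/square_summableP; case: f. Qed.

Lemma l2dot_summable (f g : l2) : csummable (fun j => f j * Num.conj (g j)).
Proof.
split; apply: rsummable_le (rsummableD (l2P f) (l2P g)) => j;
  case: (f j) (g j) => a b [x y]; rewrite /sqmod /=.
- rewrite ler_norml; apply/andP; split.
  + have := sqr_ge0 (a + x); have := sqr_ge0 (b + y); nra.
  + have := sqr_ge0 (a - x); have := sqr_ge0 (b - y); nra.
- rewrite ler_norml; apply/andP; split.
  + have := sqr_ge0 (a - y); have := sqr_ge0 (b + x); nra.
  + have := sqr_ge0 (a + y); have := sqr_ge0 (b - x); nra.
Qed.

Fact l2dot_linearl (g : l2) : GRing.linear_for *%R (l2dot^~ g).
Proof.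
move=> c f h; rewrite /l2dot -csumZ; last exact: l2dot_summable.
rewrite -csumD; [|exact/csummableZ/l2dot_summable|exact: l2dot_summable].
by congr csum; apply/funext => j; rewrite /= mulrA -mulrDl.
Qed.

Fact l2dotC (f g : l2) : l2dot f g = (-1) ^+ false * Num.conj (l2dot g f).
Proof.
rewrite mul1r /l2dot -csum_conj; last exact: l2dot_summable.
by congr csum; apply/funext => j; rewrite rmorphM /= conjCK mulrC.
Qed.

Fact l2dot_linearr (f : l2) : GRing.linear_for (Num.conj \; *%R) (l2dot f).
Proof.
move=> c g h; rewrite l2dotC mul1r (l2dot_linearl f) rmorphD rmorphM/=.
by rewrite -[Num.conj (l2dot g f)]mul1r -[Num.conj (l2dot h f)]mul1r -!l2dotC.
Qed.

Lemma l2dotE (f : l2) :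
  l2dot f f = (rsum (fun j => sqmod (f j)))%:C%C.
Proof.
apply/eqP; rewrite eq_complex /l2dot /csum /=; apply/andP; split; apply/eqP.
- by congr rsum; apply/funext => j; case: (f j) => a b; rewrite /sqmod /=; lra.
- rewrite (_ : (fun j => _) = cst 0); last first.
    by apply/funext => j; case: (f j) => a b; rewrite /cst /=; ring.
  rewrite rsum_ge0//; last by apply/rsummable_ge0 => //; rewrite esum1.
  by rewrite esum1.
Qed.

Fact l2dot_gt0 (f : l2) : f != 0 -> 0 < l2dot f f.
Proof.
move=> f0; rewrite l2dotE ltcR.
have [j fj] : exists j, f j != 0.
  apply/not_existsP => H; case/eqP: f0; apply/val_inj/funext => j.
  by apply/eqP/negP => /negP /H.
apply: lt_le_trans (rsum_ge j (fun k => sqmod_ge0 (f k)) (l2P f)).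
rewrite lt_neqAle sqmod_ge0 andbT eq_sym; apply: contra fj.
rewrite /sqmod paddr_eq0 ?sqr_ge0// !sqrf_eq0 => /andP[a b].
by rewrite eq_complex a.
Qed.

HB.instance Definition _ := bilinear_isBilinear.Build R[i] l2 l2 R[i] *%R
  (Num.conj \; *%R) l2dot (l2dot_linearl, l2dot_linearr).
HB.instance Definition _ := isHermitianSesquilinear.Build R[i] l2 false
  Num.conj l2dot l2dotC.
HB.instance Definition _ := isDotProduct.Build R[i] l2 l2dot l2dot_gt0.

End l2.

Definition l2form (R : realType) (J : choiceType) :
  {dot (l2 R J) for Num.conj} := [the {dot _ for _} of @l2dot R J].

Definition hnorm (R : realType) (V : lmodType R[i]) (d : {dot V for Num.conj})
  (v : V) : R := Num.sqrt (Re (d v v)).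

Definition hcauchy (R : realType) (V : lmodType R[i])
    (d : {dot V for Num.conj}) (u : nat -> V) :=
  forall e : R, 0 < e ->
    exists N, forall m n, (N <= m)%N -> (N <= n)%N -> hnorm d (u m - u n) < e.

Definition hconverges (R : realType) (V : lmodType R[i])
    (d : {dot V for Num.conj}) (u : nat -> V) (l : V) :=
  (fun n => hnorm d (u n - l)) @ \oo --> (0 : R).

(* As for [{dot _ for _}] in general, the inner product is linear in its first
   argument and conjugate-linear in the second one. *)
HB.mixin Record isHilbert (R : realType) V of GRing.Lmodule R[i] V := {
  hdot : {dot V for Num.conj};
  hilbert_complete : forall u : nat -> V,
    hcauchy hdot u -> exists l, hconverges hdot u l
}.

#[short(type="hilbertType")]
HB.structure Definition Hilbert (R : realType) :=
  {V of isHilbert R V & GRing.Lmodule R[i] V}.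

Section l2_complete.
Variables (R : realType) (J : choiceType).
Local Notation dot := (l2form R J).

Lemma hnorm_l2E (f : l2 R J) : hnorm dot f ^+ 2 = rsum (fun j => sqmod (f j)).
Proof.
have E : dot f f = _ := l2dotE f; rewrite /hnorm E /= sqr_sqrtr//
  rsum_ge0//; last exact: l2P.
- by rewrite fine_ge0// esum_ge0// => j _; rewrite lee_fin sqmod_ge0.
- by move=> j; exact: sqmod_ge0.
Qed.

Lemma l2_fsum_le (f : l2 R J) (A : set J) : finite_set A ->
  \sum_(j \in A) sqmod (f j) <= hnorm dot f ^+ 2.
Proof.
move=> fA; rewrite hnorm_l2E rsum_ge0; last 2 first.
- by move=> j; exact: sqmod_ge0.
- exact: l2P.
rewrite -lee_fin fineK; last first.
  by apply: esum_fin (l2P f) => j; exact: sqmod_ge0.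
by rewrite -fsumEFin//; apply: esum_ge; exists A.
Qed.

Lemma esum_le_fsum (g : J -> R) (M : R) :
  (forall A, finite_set A -> \sum_(j \in A) g j <= M) ->
  (\esum_(j in [set: J]) (g j)%:E <= M%:E)%E.
Proof.
move=> gM; apply: ge_ereal_sup => _ [A [fA _] <-].
by rewrite fsumEFin// lee_fin gM.
Qed.

Fact l2_complete (u : nat -> l2 R J) :
  hcauchy dot u -> exists l, hconverges dot u l.
Proof.
move=> cu.
have sqr_lt (x e : R) : 0 < e -> x ^+ 2 < e ^+ 2 -> `|x| < e.
  move=> e0 xe.
  by rewrite -(gtr0_norm e0) -ltr_sqr ?nnegrE// !real_normK ?num_real.
have coord (f : l2 R J) j (e : R) : 0 < e -> hnorm dot f < e ->
    `|Re (f j)| < e /\ `|Im (f j)| < e.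
  move=> e0 fe.
  have := l2_fsum_le f (finite_set1 j); rewrite fsbig_set1 /sqmod.
  have h0 : 0 <= hnorm dot f by exact: sqrtr_ge0.
  have : hnorm dot f ^+ 2 < e ^+ 2 by rewrite ltr_pXn2r// nnegrE ltW.
  move=> h1 h2; split.
  + apply: sqr_lt => //; have := sqr_ge0 (Im (f j)); lra.
  + apply: sqr_lt => //; have := sqr_ge0 (Re (f j)); lra.
have cvg_part (p : R[i] -> R) : (forall f e j, 0 < e -> hnorm dot f < e ->
      `|p (f j)| < e) -> (forall x y, p (x - y) = p x - p y) ->
    forall j, cvg ((fun n => p (u n j)) @ \oo).
  move=> pe pB j; apply/cauchy_cvgP/cauchy_exP => e e0.
  have [N HN] := cu _ e0; exists (p (u N j)).
  exists N => // n /= Nn; rewrite /ball /= -pB.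
  by have := pe (u N - u n) e j e0; apply; exact: HN.
have ReB (x y : R[i]) : Re (x - y) = Re x - Re y by case: x; case: y.
have ImB (x y : R[i]) : Im (x - y) = Im x - Im y by case: x; case: y.
have cR := cvg_part (@complex.Re R) (fun f e j e0 h => (coord f j e e0 h).1)
  ReB.
have cI := cvg_part (@complex.Im R) (fun f e j e0 h => (coord f j e e0 h).2)
  ImB.
pose l j : R[i] := (lim ((fun n => Re (u n j)) @ \oo)
  +i* lim ((fun n => Im (u n j)) @ \oo))%C.
have fin_le (e : R) : 0 < e -> exists N, forall n, (N <= n)%N ->
    forall A, finite_set A -> \sum_(j \in A) sqmod (u n j - l j) <= e ^+ 2.
  move=> e0; have [N HN] := cu _ e0; exists N => n Nn A fA.
  have cA : (fun m => \sum_(j \in A) sqmod (u n j - u m j)) @ \oo -->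
      \sum_(j \in A) sqmod (u n j - l j).
    rewrite fsbig_finite//; under eq_fun do rewrite fsbig_finite//.
    apply: cvg_big => [|j _]; first exact: add_continuous.
    have cRe : (fun m => Re (u n j - u m j)) @ \oo --> Re (u n j - l j).
      under eq_fun do rewrite ReB.
      by rewrite ReB; apply: cvgB; [exact: cvg_cst|exact: cR].
    have cIm : (fun m => Im (u n j - u m j)) @ \oo --> Im (u n j - l j).
      under eq_fun do rewrite ImB.
      by rewrite ImB; apply: cvgB; [exact: cvg_cst|exact: cI].
    rewrite /sqmod; under eq_fun do rewrite !expr2.
    by rewrite !expr2; apply: cvgD; apply: cvgM.
  rewrite -(cvg_lim _ cA)//; apply: limr_le.
    by apply/cvg_ex; eexists; exact: cA.
  exists N => // m /= Nm; apply: le_trans (l2_fsum_le (u n - u m) fA) _.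
  rewrite ler_pXn2r// ?nnegrE ?sqrtr_ge0 ?ltW//; exact: HN.
have lin : l \in @square_summable R J.
  have [N HN] := fin_le 1 ltr01.
  have sN : (u N : J -> R[i]) - l \in @square_summable R J.
    apply/asboolP; apply: le_lt_trans (esum_le_fsum (HN _ (leqnn N))) _.
    exact: ltry.
  have -> : l = (u N : J -> R[i]) - ((u N : J -> R[i]) - l).
    by rewrite opprB addrC subrK.
  by apply: rpredB => //; case: (u N).
exists (L2 lin); apply/cvgrPdist_le => e e0.
have [N HN] := fin_le _ e0; exists N => // n /= Nn.
rewrite sub0r normrN ger0_norm ?sqrtr_ge0//.
suff : hnorm dot (u n - L2 lin) ^+ 2 <= e ^+ 2.
  by rewrite ler_sqr// nnegrE ?sqrtr_ge0 ?ltW.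
rewrite hnorm_l2E rsum_ge0; last 2 first.
- by move=> j; exact: sqmod_ge0.
- exact: l2P.
rewrite -lee_fin fineK; last first.
  by apply: esum_fin (l2P _) => j; exact: sqmod_ge0.
exact: esum_le_fsum (HN _ Nn).
Qed.

HB.instance Definition _ := isHilbert.Build R (l2 R J) l2_complete.

End l2_complete.

Section complex_line.
Variable R : realType.

Definition cdot (x y : R[i]^o) : R[i] := x * Num.conj y.

Fact cdot_linearl (y : R[i]^o) : GRing.linear_for *%R (cdot^~ y).
Proof. by move=> c x z; rewrite /cdot mulrDl mulrA. Qed.

Fact cdot_linearr (x : R[i]^o) : GRing.linear_for (Num.conj \; *%R) (cdot x).
Proof.
by move=> c y z; rewrite /cdot rmorphD rmorphM mulrDr mulrCA.
Qed.

Fact cdotC (x y : R[i]^o) : cdot x y = (-1) ^+ false * Num.conj (cdot y x).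
Proof. by rewrite mul1r /cdot rmorphM /= conjCK mulrC. Qed.

Fact cdot_gt0 (x : R[i]^o) : x != 0 -> 0 < cdot x x.
Proof. by move=> x0; rewrite /cdot -normCK exprn_gt0// normr_gt0. Qed.

HB.instance Definition _ := bilinear_isBilinear.Build R[i] R[i]^o R[i]^o R[i]
  *%R (Num.conj \; *%R) cdot (cdot_linearl, cdot_linearr).
HB.instance Definition _ := isHermitianSesquilinear.Build R[i] R[i]^o false
  Num.conj cdot cdotC.
HB.instance Definition _ := isDotProduct.Build R[i] R[i]^o cdot cdot_gt0.

Definition cform : {dot R[i]^o for Num.conj} := [the {dot _ for _} of cdot].

Lemma hnorm_cE (x : R[i]^o) : hnorm cform x = Num.sqrt (sqmod x).
Proof.
by rewrite /hnorm; congr Num.sqrt; case: x => a b; rewrite /sqmod /=; ring.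
Qed.

Fact complex_complete (u : nat -> R[i]^o) :
  hcauchy cform u -> exists l, hconverges cform u l.
Proof.
move=> cu.
have ReB (x y : R[i]) : Re (x - y) = Re x - Re y by case: x; case: y.
have ImB (x y : R[i]) : Im (x - y) = Im x - Im y by case: x; case: y.
have cR : cvg ((fun n => Re (u n)) @ \oo).
  apply/cauchy_cvgP/cauchy_exP => e e0; have [N HN] := cu _ e0.
  exists (Re (u N)); exists N => // n /= Nn; rewrite /ball /= -ReB.
  apply: le_lt_trans (HN _ _ (leqnn N) Nn); rewrite hnorm_cE -sqrtr_sqr.
  by rewrite ler_sqrt ?addr_ge0 ?sqr_ge0// lerDl sqr_ge0.
have cI : cvg ((fun n => Im (u n)) @ \oo).
  apply/cauchy_cvgP/cauchy_exP => e e0; have [N HN] := cu _ e0.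
  exists (Im (u N)); exists N => // n /= Nn; rewrite /ball /= -ImB.
  apply: le_lt_trans (HN _ _ (leqnn N) Nn); rewrite hnorm_cE -sqrtr_sqr.
  by rewrite ler_sqrt ?addr_ge0 ?sqr_ge0// lerDr sqr_ge0.
pose l : R[i]^o := (lim ((fun n => Re (u n)) @ \oo)
  +i* lim ((fun n => Im (u n)) @ \oo))%C.
exists l; rewrite /hconverges; under eq_fun do rewrite hnorm_cE.
have c0 : (fun n => sqmod (u n - l)) @ \oo --> (0 : R).
  have hR : (fun n => Re (u n - l)) @ \oo --> (0 : R).
    under eq_fun do rewrite ReB.
    by rewrite -(subrr (Re l)); apply: cvgB; [exact: cR|exact: cvg_cst].
  have hI : (fun n => Im (u n - l)) @ \oo --> (0 : R).
    under eq_fun do rewrite ImB.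
    by rewrite -(subrr (Im l)); apply: cvgB; [exact: cI|exact: cvg_cst].
  rewrite /sqmod; under eq_fun do rewrite !expr2.
  by rewrite -[0]addr0 -(mulr0 0); apply: cvgD; apply: cvgM.
have := cvg_comp _ _ c0 (@sqrt_continuous R 0); rewrite sqrtr0; exact.
Qed.

HB.instance Definition _ := isHilbert.Build R R[i]^o complex_complete.

Definition Cline : hilbertType R := [the hilbertType R of R[i]^o].

End complex_line.

Section hilbert_sum.
Variables (R : realType) (H1 H2 : hilbertType R).

(* An alias of the product, so that the norm is the Hilbert norm and not the
   sup norm of products of normed modules. *)
Definition hsum : Type := (H1 * H2)%type.

HB.instance Definition _ := GRing.Lmodule.on hsum.

Definition sumdot (x y : hsum) : R[i] := hdot x.1 y.1 + hdot x.2 y.2.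

Fact sumdot_linearl (y : hsum) : GRing.linear_for *%R (sumdot^~ y).
Proof.
move=> c x z; rewrite /sumdot !linearPl/= mulrDr.
by rewrite addrACA.
Qed.

Fact sumdot_linearr (x : hsum) :
  GRing.linear_for (Num.conj \; *%R) (sumdot x).
Proof.
move=> c y z; rewrite /sumdot !linearPr/= mulrDr.
by rewrite addrACA.
Qed.

Fact sumdotC (x y : hsum) : sumdot x y = (-1) ^+ false * Num.conj (sumdot y x).
Proof.
by rewrite mul1r /sumdot rmorphD/= [hdot x.1 _]hermC [hdot x.2 _]hermC !mul1r.
Qed.

Fact sumdot_gt0 (x : hsum) : x != 0 -> 0 < sumdot x x.
Proof.
case: x => x y; rewrite /sumdot /= => xy.
have [x0|x0] := eqVneq x 0.
  rewrite x0 linear0l add0r neq0_dnorm_gt0//; apply: contra xy => /eqP ->.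
  by rewrite x0.
by rewrite ltr_wpDr ?neq0_dnorm_gt0// dnorm_ge0.
Qed.

HB.instance Definition _ := bilinear_isBilinear.Build R[i] hsum hsum R[i]
  *%R (Num.conj \; *%R) sumdot (sumdot_linearl, sumdot_linearr).
HB.instance Definition _ := isHermitianSesquilinear.Build R[i] hsum false
  Num.conj sumdot sumdotC.
HB.instance Definition _ := isDotProduct.Build R[i] hsum sumdot sumdot_gt0.

Definition sumform : {dot hsum for Num.conj} := [the {dot _ for _} of sumdot].

Lemma Re_dnorm_ge0 (H : hilbertType R) (x : H) : 0 <= Re (hdot x x).
Proof.
by have := dnorm_ge0 (hdot : {dot H for Num.conj}) x; rewrite lecE => /andP[].
Qed.

Lemma hnorm_sumE (x : hsum) :
  hnorm sumform x = Num.sqrt (hnorm hdot x.1 ^+ 2 + hnorm hdot x.2 ^+ 2).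
Proof.
rewrite /hnorm !sqr_sqrtr ?Re_dnorm_ge0//; congr Num.sqrt.
rewrite /sumform /= /sumdot.
by case: (hdot x.1 x.1); case: (hdot x.2 x.2).
Qed.

Fact hsum_complete (u : nat -> hsum) :
  hcauchy sumform u -> exists l, hconverges sumform u l.
Proof.
move=> cu.
have [l1 ul1] : exists l, hconverges hdot (fun n => (u n).1) l.
  apply: hilbert_complete => e e0; have [N HN] := cu _ e0.
  exists N => m n Nm Nn.
  apply: le_lt_trans (HN _ _ Nm Nn).
  rewrite hnorm_sumE -[leLHS]ger0_norm ?sqrtr_ge0//.
  by rewrite -sqrtr_sqr ler_sqrt ?addr_ge0 ?sqr_ge0// lerDl sqr_ge0.
have [l2 ul2] : exists l, hconverges hdot (fun n => (u n).2) l.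
  apply: hilbert_complete => e e0; have [N HN] := cu _ e0.
  exists N => m n Nm Nn.
  apply: le_lt_trans (HN _ _ Nm Nn).
  rewrite hnorm_sumE -[leLHS]ger0_norm ?sqrtr_ge0//.
  by rewrite -sqrtr_sqr ler_sqrt ?addr_ge0 ?sqr_ge0// lerDr sqr_ge0.
exists (l1, l2); rewrite /hconverges; under eq_fun do rewrite hnorm_sumE.
have c0 : (fun n => hnorm hdot ((u n).1 - l1) ^+ 2
    + hnorm hdot ((u n).2 - l2) ^+ 2) @ \oo --> (0 : R).
  under eq_fun do rewrite !expr2.
  by rewrite -[0]addr0 -(mulr0 0); apply: cvgD; apply: cvgM.
have := cvg_comp _ _ c0 (@sqrt_continuous R 0); rewrite sqrtr0; exact.
Qed.

HB.instance Definition _ := isHilbert.Build R hsum hsum_complete.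

End hilbert_sum.

Section operators.
Variables (R : realType) (H : hilbertType R).
Implicit Types (S A T X Y : H -> H) (F : set (H -> H)).

(* Operators are plain functions; boundedness is imposed by membership in
   [bounded_operators]. *)
Definition bounded_operators : set (H -> H) :=
  [set T | linear T /\
    exists M : R, forall v, hnorm hdot (T v) <= M * hnorm hdot v].

Definition scalar_operators : set (H -> H) :=
  [set T | exists c : R[i], T = fun v => c *: v].

Definition is_adjoint X Y := forall u v, hdot (X u) v = hdot u (Y v).

Definition commutant F : set (H -> H) :=
  [set T | bounded_operators T /\ forall X, F X -> T \o X = X \o T].

Definition bicommutant F : set (H -> H) := commutant (commutant F).

(* Only meaningful for bounded [T]. *)
Definition opnorm T : R :=
  sup [set hnorm hdot (T v) | v in [set v | hnorm hdot v <= 1]].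

Definition norm_closure F : set (H -> H) :=
  [set T | bounded_operators T /\
    forall e : R, 0 < e -> exists2 X, F X & opnorm (T \- X) < e].

Definition linear_span F : set (H -> H) :=
  [set T | exists n (c : 'I_n -> R[i]) (X : 'I_n -> H -> H),
    (forall k, F (X k)) /\ T = fun v => \sum_(k < n) c k *: X k v].

(* Every bounded operator of a Hilbert space has a unique adjoint, so that
   [algebra_adjoint] is closure under the involution. *)
Record is_unital_star_algebra F : Prop := {
  algebra_bounded : F `<=` bounded_operators;
  algebra_unit : F idfun;
  algebra_linear : forall c X Y, F X -> F Y -> F (fun v => c *: X v + Y v);
  algebra_comp : forall X Y, F X -> F Y -> F (X \o Y);
  algebra_adjoint : forall X Y, F X -> bounded_operators Y ->
    is_adjoint X Y -> F Y
}.

Definition is_Cstar_algebra F :=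
  is_unital_star_algebra F /\ norm_closure F `<=` F.

Definition is_vN_algebra F :=
  is_unital_star_algebra F /\ bicommutant F = F.

Definition Cstar_generated F : set (H -> H) := smallest is_Cstar_algebra F.

Definition vN_generated F : set (H -> H) := smallest is_vN_algebra F.

(* The bounded operator that is the limit for the strong operator topology
   (zero if there is none). *)
Definition strong_limit (T_ : nat -> H -> H) : H -> H :=
  xget (fun=> 0) [set T | bounded_operators T /\
    forall v, hconverges hdot (fun n => T_ n v) (T v)].

End operators.
Arguments bounded_operators {R} H.
Arguments scalar_operators {R} H.

Section GNS.
Variables (R : realType) (K H : hilbertType R).

(* [pi] is a function on all maps of [K], but only its values on the algebra
   [A] matter: it is a unital *-representation of [A] with cyclic vector [xi]
   implementing the state [phi]. *)
Record is_GNS_triple (A : set (K -> K)) (phi : (K -> K) -> R[i])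
    (pi : (K -> K) -> (H -> H)) (xi : H) : Prop := {
  gns_bounded : forall X, A X -> bounded_operators H (pi X);
  gns_unit : pi idfun = idfun;
  gns_linear : forall c X Y, A X -> A Y ->
    pi (fun v => c *: X v + Y v) = fun v => c *: pi X v + pi Y v;
  gns_comp : forall X Y, A X -> A Y -> pi (X \o Y) = pi X \o pi Y;
  gns_adjoint : forall X Y, A X -> A Y -> is_adjoint X Y ->
    is_adjoint (pi X) (pi Y);
  gns_state : forall X, A X -> hdot (pi X xi) xi = phi X;
  gns_cyclic : forall (v : H) (e : R), 0 < e ->
    exists2 X, A X & hnorm hdot (v - pi X xi) < e
}.

End GNS.

Section direct_sum.
Variables (R : realType) (H1 H2 : hilbertType R).

Definition opsum (A : H1 -> H1) (B : H2 -> H2) : hsum H1 H2 -> hsum H1 H2 :=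
  fun v => (A v.1, B v.2).

Definition opsum_set (F : set (H1 -> H1)) (G : set (H2 -> H2)) :
  set (hsum H1 H2 -> hsum H1 H2) := [set opsum A B | A in F & B in G].

End direct_sum.

Section l2_maps.
Variables (R : realType) (J : choiceType).

Fact l2e_subproof (i : J) :
  (fun j => (j == i)%:R) \in @square_summable R J.
Proof.
apply/asboolP; apply: (@le_lt_trans _ _ 1%E); last exact: ltry.
apply: esum_le_fsum => A fA; rewrite (fsbigID [set i])//=.
rewrite [X in _ + X]fsbig1 => [|j [_ /eqP/negbTE ji]]; last first.
  by rewrite /sqmod ji /= expr0n /= addr0.
rewrite addr0; have [Ai|Ai] := pselect (A i).
  rewrite (_ : A `&` [set i] = [set i]); last first.
    by apply/seteqP; split => j /= [] // ->.
  by rewrite fsbig_set1 /sqmod eqxx /= expr1n expr0n /= addr0.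
rewrite (_ : A `&` [set i] = set0); last first.
  by apply/seteqP; split => j //= [Aj ji]; rewrite ji in Aj.
by rewrite fsbig_set0 ler01.
Qed.

Definition l2e (i : J) : l2 R J := L2 (l2e_subproof i).

Fact pullback_subproof (p : J -> option J) (f : l2 R J) :
  (forall i j k, p i = Some k -> p j = Some k -> i = j) ->
  (fun j => oapp f 0 (p j)) \in @square_summable R J.
Proof.
move=> p_inj; have sf : (\esum_(j in [set: J]) (sqmod (f j))%:E < +oo)%E.
  by have /asboolP := valP f.
apply/asboolP; apply: le_lt_trans sf.
pose D := [set j | p j]; pose e j := odflt j (p j).
have eq0 : sqmod (0 : R[i]) = 0 by rewrite /sqmod /= expr0n /= addr0.
apply: (@le_trans _ _ (\esum_(j in D) (sqmod (f (e j)))%:E)%E).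
  rewrite [leRHS]esum_mkcond; apply: le_esum => j _; rewrite /e.
  case: ifPn => [/set_mem|/negP jD]; rewrite ?/D /=.
    by case: (p j).
  case pj : (p j) => [k|] /=; last by rewrite eq0.
  by exfalso; apply: jD; apply/mem_set; rewrite /D /= pj.
have be : set_bij D (e @` D) e.
  split => [j Dj|i j /set_mem Di /set_mem Dj|//]; first by exists j.
  rewrite /e; move: Di Dj; rewrite /D /=.
  case pi : (p i) => [k|//]; case pj : (p j) => [k'|//] _ _ /= kk.
  by apply: p_inj pi _; rewrite kk.
rewrite -(@reindex_esum _ _ _ _ _ _ (fun j => (sqmod (f j))%:E) be).
rewrite [leLHS]esum_mkcond; apply: le_esum => j _.
by case: ifP => _ //; rewrite lee_fin sqmod_ge0.
Qed.

End l2_maps.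
Arguments l2e R {J}.

(* The disjoint union of the index sets I_k, k >= 0: the empty word is the
   unique element of I_0 and indexes the vacuum vector. Thus l2 over [word] is
   the Hilbert direct sum of the l2(I_k). *)
Definition word := {s : seq int | sorted <%R s}.

Definition empty_word : word :=
  exist (fun s : seq int => sorted <%R s) [::] isT.

(* [push i w] prepends [i] to [w] and is [None] unless the result is
   increasing; [pop i] is the partial inverse, removing a leading [i]. *)
Definition push (i : int) (w : word) : option word := insub (i :: val w).

Definition pop (i : int) (w : word) : option word :=
  if val w is k :: s then if k == i then insub s else None else None.

Lemma popP (i : int) (u w : word) : pop i u = Some w <-> val u = i :: val w.
Proof.
rewrite /pop; case: u => -[|k s] /= us; first by split.
case: eqVneq => [->|ki]; last by split=> // -[/eqP]; rewrite (negbTE ki).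
by case: insubP => [v _ vs|]; [split=> [[<-]|[sw]]; [rewrite vs|congr Some;
  apply/val_inj; rewrite /= vs]|rewrite (path_sorted us)].
Qed.

Lemma pushP (i : int) (u w : word) : push i w = Some u <-> val u = i :: val w.
Proof.
rewrite /push; case: insubP => [v _ vs|iw]; split=> //.
- by case=> <-.
- by move=> ui; congr Some; apply/val_inj; rewrite /= vs.
- by move=> ui; have := valP u; rewrite ui (negbTE iw).
Qed.

Section monotone_Fock.
Variable R : realType.
Implicit Types (i j k : int) (w : word).

Definition Fock : hilbertType R := [the hilbertType R of l2 R word].

Definition vacuum : Fock := l2e R empty_word.

Fact creation_subproof i (f : Fock) :
  (fun w => oapp f 0 (pop i w)) \in @square_summable R word.
Proof.
apply: pullback_subproof => u v w /popP uw /popP vw.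
by apply/val_inj; rewrite /= uw vw.
Qed.

Fact annihilation_subproof i (f : Fock) :
  (fun w => oapp f 0 (push i w)) \in @square_summable R word.
Proof.
apply: pullback_subproof => u v w /pushP uw /pushP vw.
by apply/val_inj; move: uw; rewrite vw => -[].
Qed.

(* On coordinates, (a_i^dagger f)(i w) = f(w), and a_i^dagger f vanishes at the
   words not starting with i; dually (a_i f)(w) = f(i w). The action on the
   basis is in [creation_basis] and [annihilation_basis]. *)
Definition creation i (f : Fock) : Fock := L2 (creation_subproof i f).

Definition annihilation i (f : Fock) : Fock := L2 (annihilation_subproof i f).

Lemma creation_basis i w : creation i (l2e R w) = oapp (l2e R) 0 (push i w).
Proof.
apply/val_inj/funext => u /=.
have -> : oapp (l2e R w) 0 (pop i u) = (pop i u == Some w)%:R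
  by case: (pop i u).
have -> : val (oapp (l2e R) 0 (push i w)) u = (push i w == Some u)%:R.
  by case: (push i w) => [v|] //=; rewrite eq_sym.
by congr (_%:R); congr nat_of_bool; apply/eqP/eqP => [/popP/pushP|/pushP/popP].
Qed.

Lemma annihilation_basis i w :
  annihilation i (l2e R w) = oapp (l2e R) 0 (pop i w).
Proof.
apply/val_inj/funext => u /=.
have -> : oapp (l2e R w) 0 (push i u) = (push i u == Some w)%:R
  by case: (push i u).
have -> : val (oapp (l2e R) 0 (pop i w)) u = (pop i w == Some u)%:R.
  by case: (pop i w) => [v|] //=; rewrite eq_sym.
by congr (_%:R); congr nat_of_bool; apply/eqP/eqP => [/pushP/popP|/popP/pushP].
Qed.

Definition monotone_algebra : set (Fock -> Fock) :=
  Cstar_generated (range annihilation).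

Definition operator_word (s : seq (Fock -> Fock)) : Fock -> Fock :=
  foldr (fun X Y => X \o Y) idfun s.

(* Forms of strictly positive length; all pi-forms have length at least 2. *)
Definition positive_lambda_forms : set (Fock -> Fock) :=
  [set X | exists s t : seq int,
    [/\ sorted <%R s, sorted >%R t, (0 < size s + size t)%N &
        X = operator_word (map creation s ++ map annihilation t)]].

Definition pi_forms : set (Fock -> Fock) :=
  [set X | exists (s : seq int) (k : int) (t : seq int),
    [/\ sorted <%R (rcons s k), sorted >%R (k :: t) &
        X = operator_word (map creation s ++
              annihilation k :: creation k :: map annihilation t)]].

Definition ideal_B : set (Fock -> Fock) :=
  norm_closure (linear_span (positive_lambda_forms `|` pi_forms)).

Definition vacuum_state (Y : Fock -> Fock) : R[i] := hdot (Y vacuum) vacuum.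

(* The scalar c of the decomposition Y = X + c I with X in [ideal_B], which is
   unique and exists for Y in the monotone algebra. *)
Definition state_at_infinity (Y : Fock -> Fock) : R[i] :=
  xget 0 [set c | ideal_B (fun v => Y v - c *: v)].

Definition symmetric_state (gamma : R) (Y : Fock -> Fock) : R[i] :=
  gamma%:C%C * vacuum_state Y + (1 - gamma)%:C%C * state_at_infinity Y.

(* The GNS representations: the identity on the Fock space for the vacuum state
   (with vector [vacuum]), the state itself acting on the complex line for the
   state at infinity (with vector 1), and their direct sum for a proper convex
   combination (with vector [vector_mixed gamma]). *)
Definition rep_vacuum (Y : Fock -> Fock) : Fock -> Fock := Y.

Definition rep_infinity (Y : Fock -> Fock) : Cline R -> Cline R :=
  fun z => state_at_infinity Y *: z.

Definition rep_mixed (Y : Fock -> Fock) :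
  hsum Fock (Cline R) -> hsum Fock (Cline R) :=
  opsum (rep_vacuum Y) (rep_infinity Y).

Definition vector_mixed (gamma : R) : hsum Fock (Cline R) :=
  ((Num.sqrt gamma)%:C%C *: vacuum, (Num.sqrt (1 - gamma))%:C%C).

(* The strongly convergent sum of a_k^dagger a_k over k < j, taken in the order
   k = j - 1, j - 2, ... *)
Definition sum_below j : Fock -> Fock :=
  strong_limit (fun n v =>
    \sum_(m < n) creation (j - m.+1%:Z) (annihilation (j - m.+1%:Z) v)).

Definition vacuum_projection (v : Fock) : Fock := hdot v vacuum *: vacuum.

Definition vacuum_diagonal : set (Fock -> Fock) :=
  [set T | exists lambda mu : R[i], T = fun v =>
    lambda *: vacuum_projection v + mu *: (v - vacuum_projection v)].

Section process.
Variables (H : hilbertType R) (pi : (Fock -> Fock) -> (H -> H)).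

(* The sample algebra is M_2(C) (+) C; the indices 1, 2 of 2 x 2 matrices
   are the ordinals 0, 1. *)
Definition process j (x : 'M[R[i]]_2 * R[i]) : H -> H :=
  pi (fun v => x.1 0 0 *: annihilation j (creation j v)
             + x.1 0 1 *: annihilation j v
             + x.1 1 0 *: creation j v
             + x.1 1 1 *: creation j (annihilation j v)
             + x.2 *: sum_below j v).

Definition tail_algebra : set (H -> H) :=
  \bigcap_(I in [set I : set int | finite_set I])
    bicommutant (\bigcup_(K in [set K | finite_set K /\ K `&` I = set0])
      vN_generated (\bigcup_(k in K) range (process k))).

End process.

End monotone_Fock.

(* Main.v *)
Require Import Defs.
From mathcomp Require Import all_boot all_order all_algebra.
From mathcomp Require Import complex finmap zify ring lra.
From mathcomp Require Import boolp classical_sets cardinality fsbigop.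
From mathcomp Require Import reals ereal normedtype esum.

(** The generators [annihilation i] and [creation i] act on the coordinates of
    the Fock space through partial bijections of increasing words; so do their
    products, and identities between them become identities between partial
    maps on words.

    The state at infinity. The lambda-forms of positive length and the pi-forms
    are exactly the operators [generic_form s k t] with [s] increasing and [t]
    decreasing ([formsE]), and these are stable, up to zero, under
    multiplication by the generators ([cre_forms], [ann_forms]). Each of them kills the basis vectors [far n] of the words
    [:: - n] for large [n]. Thus an operator of [ideal_B] tends to zero along
    [far n], and the scalar part of an operator is at most its norm. It follows
    that the operators that are sums of an element of [ideal_B] and of a scalar
    form a C*-algebra ([infinity_algebra]), which contains the monotone
    algebra, and that the state at infinity is the character giving the
    asymptotic eigenvalue along [far n] ([stateP]). The three GNS triples are
    then direct verifications; cyclicity holds because the words in the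
    creation operators carry the vacuum to the whole canonical basis.

    The generated von Neumann algebras. An operator that commutes with all the
    generators maps the vacuum to a vector killed by all annihilation
    operators, that is, to a multiple of the vacuum, and hence it is a scalar
    ([commutant_scalar]). On the direct sum with the complex line the same
    reasoning, applied to the off-diagonal blocks, shows that the commutant
    consists of pairs of scalars ([commutant_mixed]).

    The tail algebra. The projections [above n] tend strongly to the vacuum
    projection as [n] tends to plus infinity, so that projection is in the
    tail algebra. On the direct sum, the elements [sum_below (- n)] (+) 1 tend
    to the projection onto the complex line, which is therefore also in it.
    Conversely, for words [x] and [y] whose first letters lie between [- N]
    and [N], the operator [splice N x y] that turns the ending [x] into [y]
    behind letters less than [- N] commutes with all the generators of
    index outside that interval. Hence it commutes with the tail algebra. Since
    [N] is arbitrary, the basis vectors of nonempty words are eigenvectors of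
    any tail element, with one common eigenvalue, and the vacuum is an
    eigenvector as well ([splice_commutant]). *)

Set Implicit Arguments.
Unset Strict Implicit.
Unset Printing Implicit Defensive.
Import Order.TTheory GRing.Theory Num.Theory numFieldNormedType.Exports.
Local Open Scope classical_set_scope.
Local Open Scope ring_scope.
Local Notation Re := complex.Re.
Local Notation normc := ComplexField.Normc.normc.
Local Notation hn := (hnorm hdot).

(** * Norms and bounded operators *)

Section hilbert_norm.
Variables (R : realType) (H : hilbertType R).
Implicit Types (u v w : H) (c : R[i]).

Lemma hn_ge0 v : 0 <= hn v. Proof. exact: sqrtr_ge0. Qed.

Lemma hdotvv v : hdot v v = (hn v ^+ 2)%:C%C.
Proof.
rewrite /hnorm sqr_sqrtr ?Re_dnorm_ge0//.
have := dnorm_ge0 (hdot : {dot H for Num.conj}) v.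
by case: (hdot v v) => a b; rewrite lecE /= => /andP[/eqP -> _].
Qed.

Lemma hdotC u v : hdot u v = Num.conj (hdot v u).
Proof. by rewrite hermC mul1r. Qed.

Lemma hdot0l v : hdot 0 v = 0. Proof. exact: linear0l. Qed.
Lemma hdot0r v : hdot v 0 = 0. Proof. exact: linear0r. Qed.
Lemma hdotDl u v w : hdot (u + v) w = hdot u w + hdot v w.
Proof. exact: linearDl. Qed.
Lemma hdotDr u v w : hdot w (u + v) = hdot w u + hdot w v.
Proof. exact: linearDr. Qed.
Lemma hdotBl u v w : hdot (u - v) w = hdot u w - hdot v w.
Proof. exact: linearBl. Qed.
Lemma hdotBr u v w : hdot w (u - v) = hdot w u - hdot w v.
Proof. exact: linearBr. Qed.
Lemma hdotZl c u v : hdot (c *: u) v = c * hdot u v.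
Proof. exact: linearZl_LR. Qed.
Lemma hdotZr c u v : hdot u (c *: v) = Num.conj c * hdot u v.
Proof. by rewrite hdotC hdotZl rmorphM [hdot u v]hdotC. Qed.

Lemma hn_eq0 v : hn v = 0 -> v = 0.
Proof.
move=> v0; apply/eqP; rewrite -(dnorm_eq0 (hdot : {dot H for Num.conj})).
by rewrite hdotvv v0 expr0n.
Qed.

Lemma hn0 : hn (0 : H) = 0.
Proof. by rewrite /hnorm hdot0l sqrtr0. Qed.

Lemma norm_normc c : `|c| = (normc c)%:C%C. Proof. by case: c. Qed.

Lemma normc_ge0 c : 0 <= normc c. Proof. by case: c => a b; exact: sqrtr_ge0. Qed.

Lemma hnZ c v : hn (c *: v) = normc c * hn v.
Proof.
apply/eqP; rewrite -(@eqrXn2 _ 2) ?mulr_ge0 ?hn_ge0 ?normc_ge0//.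
rewrite exprMn -(inj_eq (@complexI R)) -hdotvv hdotZl hdotZr mulrA -normCK.
by rewrite norm_normc hdotvv -rmorphXn -rmorphM.
Qed.

Lemma hnN v : hn (- v) = hn v.
Proof. by rewrite /hnorm -scaleN1r hdotZl hdotZr rmorphN1 mulrA mulrNN !mul1r. Qed.

Lemma hnBC u v : hn (u - v) = hn (v - u).
Proof. by rewrite -hnN opprB. Qed.

Lemma cauchy_schwarz u v : normc (hdot u v) <= hn u * hn v.
Proof.
have [->|v0] := eqVneq v 0.
  by rewrite hdot0r ComplexField.Normc.normc0 mulr_ge0 ?hn_ge0.
have vp : 0 < hn v.
  by rewrite lt_neqAle hn_ge0 andbT eq_sym; apply: contra v0 => /eqP/hn_eq0 ->.
pose b : R[i] := (hn v ^+ 2)%:C%C; pose d := hdot u v.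
have bC : Num.conj b = b by apply/eqP; rewrite eq_complex /= oppr0 !eqxx.
have dd : d * Num.conj d = (normc d ^+ 2)%:C%C.
  by rewrite -normCK norm_normc rmorphXn.
(* The multiple [b *: u - d *: v] of the component of [u] orthogonal to [v]
   has a nonnegative squared norm. *)
have := sqr_ge0 (hn (b *: u - d *: v)); rewrite -lecR -hdotvv.
rewrite hdotBl !hdotBr !hdotZl !hdotZr bC -/d [hdot v u]hdotC -/d !hdotvv -/b.
rewrite (_ : _ - _ = b * (b * (hn u ^+ 2)%:C%C - d * Num.conj d)); last by ring.
rewrite dd -rmorphM -rmorphB -rmorphM lecR pmulr_rge0 ?exprn_gt0//.
rewrite subr_ge0 mulrC -exprMn ler_pXn2r// nnegrE ?normc_ge0//.
by rewrite mulr_ge0 ?hn_ge0.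
Qed.

Lemma ler_Re_normc c : Re c <= normc c.
Proof.
case: c => a b /=; apply: le_trans (ler_norm _) _; rewrite -sqrtr_sqr.
by rewrite ler_sqrt ?addr_ge0 ?sqr_ge0// lerDl sqr_ge0.
Qed.

Lemma ler_hnD u v : hn (u + v) <= hn u + hn v.
Proof.
rewrite -(@ler_pXn2r _ 2) ?nnegrE ?addr_ge0 ?hn_ge0// -lecR -hdotvv.
rewrite hdotDl !hdotDr !hdotvv [hdot v u]hdotC.
have := le_trans (ler_Re_normc _) (cauchy_schwarz u v).
rewrite lecE; case: (hdot u v) => a b /= h; apply/andP; split.
  by apply/eqP; ring.
by rewrite sqrrD; lra.
Qed.

Lemma ler_hnB u v : hn (u - v) <= hn u + hn v.
Proof. by rewrite -[hn v]hnN ler_hnD. Qed.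

Lemma hconvergesP (s : nat -> H) l : hconverges hdot s l <->
  forall e : R, 0 < e -> exists N, forall n, (N <= n)%N -> hn (s n - l) < e.
Proof.
split=> [/cvgrPdist_lt h e /h [N _ HN]|h].
  exists N => n /HN /=; rewrite sub0r normrN ger0_norm//; exact: hn_ge0.
apply/cvgrPdist_lt => e /h [N HN]; exists N => // n /= /HN.
by rewrite sub0r normrN ger0_norm//; exact: hn_ge0.
Qed.

Lemma hconverges_ext (s t : nat -> H) l m : (forall n, s n = t n) -> l = m ->
  hconverges hdot s l -> hconverges hdot t m.
Proof. by move=> /funext -> ->. Qed.

Lemma hn_small0 v : (forall e : R, 0 < e -> hn v < e) -> v = 0.
Proof.
move=> h; apply: hn_eq0; apply/eqP; rewrite eq_le hn_ge0 andbT leNgt.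
by apply/negP => /h; rewrite ltxx.
Qed.

Lemma hconverges_unique (s : nat -> H) l m :
  hconverges hdot s l -> hconverges hdot s m -> l = m.
Proof.
move=> /hconvergesP sl /hconvergesP sm; apply/eqP; rewrite -subr_eq0; apply/eqP.
apply: hn_small0 => e e0; have e2 : 0 < e / 2 by rewrite divr_gt0.
have [N HN] := sl _ e2; have [M HM] := sm _ e2.
have := HN _ (leq_maxl N M); have := HM _ (leq_maxr N M).
set x := s _ => h1 h2; have -> : l - m = (x - m) - (x - l).
  by rewrite opprB [RHS]addrC addrA subrK.
apply: le_lt_trans (ler_hnB _ _) _; lra.
Qed.

Lemma hconvergesD (s t : nat -> H) l m : hconverges hdot s l ->
  hconverges hdot t m -> hconverges hdot (fun n => s n + t n) (l + m).
Proof.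
move=> /hconvergesP sl /hconvergesP tm; apply/hconvergesP => e e0.
have e2 : 0 < e / 2 by rewrite divr_gt0.
have [N HN] := sl _ e2; have [M HM] := tm _ e2; exists (maxn N M) => n.
rewrite geq_max => /andP[/HN h1 /HM h2]; rewrite opprD addrACA.
apply: le_lt_trans (ler_hnD _ _) _; lra.
Qed.

End hilbert_norm.

Lemma eps_div (R : realType) (M e : R) : 0 <= M -> 0 < e ->
  0 < e / (M + 1) /\ M * (e / (M + 1)) < e.
Proof.
move=> M0 e0; have M1 : 0 < M + 1 by lra.
split; first by rewrite divr_gt0.
by rewrite mulrA ltr_pdivrMr// mulrC; nra.
Qed.

Section linear_maps.
Variables (R : realType) (H K : hilbertType R).
Variables (T : H -> K) (linT : linear T).

Lemma lin0 : T 0 = 0.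
Proof. by have := linT (-1) 0 0; rewrite scaler0 add0r scaleN1r addNr. Qed.
Lemma linD u v : T (u + v) = T u + T v.
Proof. by have := linT 1 u v; rewrite !scale1r. Qed.
Lemma linZ c v : T (c *: v) = c *: T v.
Proof. by have := linT c v 0; rewrite lin0 !addr0. Qed.
Lemma linN v : T (- v) = - T v.
Proof. by rewrite -scaleN1r linZ scaleN1r. Qed.
Lemma linB u v : T (u - v) = T u - T v.
Proof. by rewrite linD linN. Qed.
Lemma lin_sum I (r : seq I) (P : pred I) F :
  T (\sum_(i <- r | P i) F i) = \sum_(i <- r | P i) T (F i).
Proof.
elim/big_rec2: _ => [|i x y _ <-]; first exact: lin0.
by rewrite linD.
Qed.

End linear_maps.

Section bounded.
Variables (R : realType) (H : hilbertType R).
Local Notation bd := (bounded_operators H).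
Implicit Types (S T X Y : H -> H) (F : set (H -> H)) (c : R[i]).

Lemma bd_lin T : bd T -> linear T. Proof. by case. Qed.

Lemma bd_bound T : bd T -> exists2 M : R, 0 <= M & forall v, hn (T v) <= M * hn v.
Proof.
move=> [_ [M TM]]; exists (Num.max M 0); first by rewrite le_max lexx orbT.
by move=> v; apply: le_trans (TM v) _; rewrite ler_wpM2r ?hn_ge0// le_max lexx.
Qed.

Lemma bd_id : bd idfun.
Proof. by split=> //; exists 1 => v; rewrite mul1r. Qed.

Lemma bdD c X Y : bd X -> bd Y -> bd (fun v => c *: X v + Y v).
Proof.
move=> bX bY; have [M M0 XM] := bd_bound bX; have [N N0 YN] := bd_bound bY.
split.
  move=> a u v; rewrite (bd_lin bX) (bd_lin bY) !scalerDr !scalerA [c * a]mulrC.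
  by rewrite addrACA.
exists (normc c * M + N) => v; apply: le_trans (ler_hnD _ _) _.
by rewrite hnZ mulrDl lerD// -mulrA ler_wpM2l// normc_ge0.
Qed.

Lemma bd0 : bd (fun=> 0).
Proof.
by split=> [c u v|]; [rewrite scaler0 add0r|exists 0 => v; rewrite hn0 mul0r].
Qed.

Lemma bdZ c X : bd X -> bd (fun v => c *: X v).
Proof.
move=> bX; have := bdD c bX bd0; congr bd; apply/funext => v.
by rewrite addr0.
Qed.

Lemma bd_scalar c : bd (fun v => c *: v). Proof. exact: bdZ bd_id. Qed.

Lemma bdB X Y : bd X -> bd Y -> bd (X \- Y).
Proof.
move=> bX bY; have := bdD (-1) bY bX; congr bd; apply/funext => v /=.
by rewrite scaleN1r addrC.
Qed.

Lemma bd_comp X Y : bd X -> bd Y -> bd (X \o Y).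
Proof.
move=> bX bY; have [M M0 XM] := bd_bound bX; have [N N0 YN] := bd_bound bY.
split=> [c u v /=|]; first by rewrite (bd_lin bY) (bd_lin bX).
exists (M * N) => v /=; apply: le_trans (XM _) _.
by rewrite -mulrA ler_wpM2l.
Qed.

Lemma bd_cvg T (s : nat -> H) l :
  bd T -> hconverges hdot s l -> hconverges hdot (fun n => T (s n)) (T l).
Proof.
move=> bT /hconvergesP sl; apply/hconvergesP => e e0.
have [M M0 TM] := bd_bound bT.
have [d0 dM] := eps_div M0 e0; have [N HN] := sl _ d0; exists N => n /HN h.
rewrite -(linB (bd_lin bT)); apply: le_lt_trans (TM _) _.
by apply: le_lt_trans dM; rewrite ler_wpM2l// ltW.
Qed.

Lemma opnorm_le T (M : R) : 0 <= M -> (forall v, hn (T v) <= M * hn v) ->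
  opnorm T <= M.
Proof.
move=> M0 TM; apply: ge_sup.
  by exists (hn (T 0)); exists 0 => //=; rewrite hn0.
by move=> _ [v /= v1 <-]; apply: le_trans (TM v) _; rewrite ler_piMr.
Qed.

Lemma ler_opnorm T v : bd T -> hn (T v) <= opnorm T * hn v.
Proof.
move=> bT; have [v0|v0] := eqVneq (hn v) 0.
  by rewrite (hn_eq0 v0) (lin0 (bd_lin bT)) !hn0 mulr0.
have vp : 0 < hn v by rewrite lt_neqAle eq_sym v0 hn_ge0.
rewrite -ler_pdivrMr//; apply: ub_le_sup.
  have [M M0 TM] := bd_bound bT; exists M => _ [u /= u1 <-].
  by apply: le_trans (TM u) _; rewrite ler_piMr.
have nc : normc ((hn v)^-1)%:C%C = (hn v)^-1.
  by rewrite /= expr0n addr0 sqrtr_sqr ger0_norm// invr_ge0 hn_ge0.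
exists (((hn v)^-1)%:C%C *: v) => /=; first by rewrite hnZ nc mulVf.
by rewrite (linZ (bd_lin bT)) hnZ nc mulrC.
Qed.

End bounded.

(** * Operators on square-summable families *)

Section l2_operators.
Variables (R : realType) (J : choiceType).
Local Notation V := (l2 R J).
Implicit Types (f g : V) (p q : J -> option J) (A : pred J) (S T : V -> V).

Lemma l2_ext f g : (forall j, f j = g j) -> f = g.
Proof. by move=> fg; apply/val_inj/funext. Qed.

Lemma l2_sumE I (r : seq I) (P : pred I) (F : I -> V) j :
  (\sum_(i <- r | P i) F i : V) j = \sum_(i <- r | P i) F i j.
Proof. by elim/big_rec2: _ => // i x y _ <-. Qed.

Lemma bessel f s : uniq s -> \sum_(j <- s) sqmod (f j) <= hn f ^+ 2.
Proof.
move=> us; have := l2_fsum_le f (finite_seq s).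
rewrite fsbig_finite//=; congr (_ <= _).
apply: perm_big; rewrite uniq_perm//.
by move=> j; rewrite in_fset_set// ; apply/idP/idP; rewrite inE.
Qed.

Lemma hn_le_fsum f (M : R) : 0 <= M ->
  (forall s, uniq s -> \sum_(j <- s) sqmod (f j) <= M ^+ 2) -> hn f <= M.
Proof.
move=> M0 h; rewrite -(@ler_pXn2r _ 2) ?nnegrE ?hn_ge0//.
have E : hn f ^+ 2 = rsum (fun j => sqmod (f j)) by exact: hnorm_l2E.
rewrite E rsum_ge0; [|by move=> j; exact: sqmod_ge0|exact: l2P].
rewrite -lee_fin fineK; last first.
  by apply: esum_fin (l2P _) => j; exact: sqmod_ge0.
by apply: esum_le_fsum => B fB; rewrite fsbig_finite//; exact/h/fset_uniq.
Qed.

(** Finite sums of the squared moduli of the coordinates come arbitrarily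
    close to the squared norm, and what they miss is the squared norm of the
    remainder. *)
Lemma l2_dense f (e : R) : 0 < e ->
  exists s, uniq s /\ hn (f - \sum_(j <- s) f j *: l2e R j) < e.
Proof.
move=> e0; pose d := e / 2; have d0 : 0 < d by rewrite divr_gt0.
have [s us hs] : exists2 s, uniq s &
    hn f ^+ 2 - d ^+ 2 < \sum_(j <- s) sqmod (f j).
  apply: contrapT => /forall2NP h; suff : hn f ^+ 2 <= hn f ^+ 2 - d ^+ 2.
    by have := exprn_gt0 2 d0; lra.
  have [m0|m0] := leP 0 (hn f ^+ 2 - d ^+ 2); last first.
    by have [//|/negP] := h [::]; rewrite big_nil m0.
  rewrite -[leRHS]sqr_sqrtr// ler_pXn2r ?nnegrE ?hn_ge0 ?sqrtr_ge0//.
  apply: hn_le_fsum => [|s us]; first exact: sqrtr_ge0.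
  by rewrite sqr_sqrtr// leNgt; have [//|/negP] := h s.
exists s; split=> //; apply: (@le_lt_trans _ _ d); last by rewrite /d; lra.
apply: hn_le_fsum (ltW d0) _ => t ut; set g := f - _.
have gE j : g j = if j \in s then 0 else f j.
  rewrite /g; change (f j - (\sum_(i <- s) f i *: l2e R i : V) j =
    if j \in s then 0 else f j).
  rewrite l2_sumE; case: ifPn => js.
    rewrite (bigD1_seq j)//= big1 ?addr0 => [|i ij].
      by change (f j - f j * (j == j)%:R = 0); rewrite eqxx mulr1 subrr.
    by change (f i * (j == i)%:R = 0); rewrite eq_sym (negbTE ij) mulr0.
  rewrite big1_seq ?subr0// => i /andP[_ si].
  change (f i * (j == i)%:R = 0); case: eqVneq => [ji|]; last by rewrite mulr0.
  by rewrite ji si in js.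
have -> : \sum_(j <- t) sqmod (g j) =
    \sum_(j <- [seq j <- t | j \notin s]) sqmod (f j).
  rewrite big_filter [RHS]big_mkcond; apply: eq_bigr => j _; rewrite gE.
  by case: (j \in s) => //=; rewrite /sqmod expr0n addr0.
have := @bessel f (s ++ [seq j <- t | j \notin s]).
rewrite cat_uniq us filter_uniq// andbT big_cat /=.
have -> : ~~ has (mem s) [seq j <- t | j \notin s].
  by apply/hasPn => j; rewrite mem_filter => /andP[].
by move=> /(_ isT); lra.
Qed.

Lemma hn_l2e j : hn (l2e R j : V) = 1.
Proof.
apply/eqP; rewrite eq_le; apply/andP; split; last first.
  rewrite -(@ler_pXn2r _ 2) ?nnegrE ?hn_ge0//.
  apply: le_trans (@bessel (l2e R j) [:: j] isT).
  by rewrite big_seq1 /= /sqmod eqxx /= expr1n expr0n addr0.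
apply: hn_le_fsum => // s us; rewrite expr1n.
have [js|js] := boolP (j \in s); last first.
  rewrite big1_seq// => i /andP[_ si] /=; case: eqVneq => [ij|_].
    by rewrite ij (negbTE js) in si.
  by rewrite /sqmod /= expr0n addr0.
rewrite (bigD1_seq j)//= big1 => [|i /negbTE ->].
  by rewrite /sqmod eqxx /= expr1n expr0n !addr0.
by rewrite /sqmod /= expr0n addr0.
Qed.

Lemma rsum_single (h : J -> R) j : (forall i, i != j -> h i = 0) ->
  rsum h = h j.
Proof.
move=> h0; pose d (i : J) : R := (i == j)%:R.
have d0 i : 0 <= d i by rewrite ler0n.
have ed : (\esum_(i in [set: J]) (d i)%:E = 1)%E.
  rewrite -[RHS](@esum_set1 _ _ j (fun=> 1%E))//.
  rewrite [RHS]esum_mkcond; apply: eq_esum => i _; rewrite in_set1 /d.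
  by case: eqVneq.
have sd : rsummable d by apply/(rsummable_ge0 d0); rewrite ed ltry.
have -> : h = fun i => h j * d i.
  apply/funext => i; rewrite /d; case: eqVneq => [->|/h0 ->]; first by rewrite mulr1.
  by rewrite mulr0.
by rewrite rsumZ// rsum_ge0// ed /d eqxx.
Qed.

Lemma hdot_l2e f j : hdot f (l2e R j : V) = f j.
Proof.
have -> : hdot f (l2e R j : V) = l2dot f (l2e R j) by [].
rewrite /l2dot /csum; rewrite !(@rsum_single _ j) /=.
- by rewrite eqxx; case: (f j) => a b /=; rewrite oppr0 !mulr0 !mulr1 subr0 add0r.
- by move=> i /negbTE ->; case: (f i) => a b /=; rewrite oppr0 !mulr0 addr0.
- by move=> i /negbTE ->; case: (f i) => a b /=; rewrite oppr0 !mulr0 subr0.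
Qed.

(** By density of the span of the basis. The bounds are hypotheses on the maps
    themselves, so that the target may be another Hilbert space. *)
Lemma bd_eq_l2e (K : hilbertType R) (S T : V -> K) :
  linear S -> linear T -> (exists2 M, 0 <= M & forall v, hn (S v) <= M * hn v) ->
  (exists2 M, 0 <= M & forall v, hn (T v) <= M * hn v) ->
  (forall j, S (l2e R j) = T (l2e R j)) -> forall v, S v = T v.
Proof.
move=> lS lT [M M0 SM] [N N0 TN] ST v; apply/eqP; rewrite -subr_eq0; apply/eqP.
apply: hn_small0 => e e0; have [d0 dM] := eps_div (addr_ge0 M0 N0) e0.
have [s [us hs]] := l2_dense v d0; set w := v - _ in hs.
have -> : S v - T v = S w - T w.
  rewrite /w (linB lS) (linB lT) (lin_sum lS) (lin_sum lT).
  under eq_bigr do rewrite (linZ lS) ST -(linZ lT).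
  by rewrite opprB addrA subrK.
apply: le_lt_trans (ler_hnB _ _) _; apply: le_lt_trans dM.
apply: (@le_trans _ _ ((M + N) * hn w)); first by rewrite mulrDl lerD.
by rewrite ler_wpM2l ?addr_ge0// ltW.
Qed.

(** A partial bijection of the index set acts on families by a partial
    isometry, whose adjoint is the action of the inverse. The creation and
    annihilation operators are of this kind, and so are the operators
    [splice] that decide the tail algebra. *)
Definition partial_inverse p q := forall i j, p i = Some j <-> q j = Some i.

Definition pulls T p := forall f j, T f j = oapp f 0 (p j).

Lemma partial_inverseC p q : partial_inverse p q -> partial_inverse q p.
Proof. by move=> pq i j; split=> /pq. Qed.

Lemma pulls_hn T p q f : partial_inverse p q -> pulls T p -> hn (T f) <= hn f.
Proof.
move=> pq Tp; apply: hn_le_fsum => [|s us]; first exact: hn_ge0.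
have -> : \sum_(j <- s) sqmod (T f j) = \sum_(j <- pmap p s) sqmod (f j).
  elim: s {us} => [|j s IH]; first by rewrite !big_nil.
  rewrite big_cons IH Tp /=; case: (p j) => [k|] /=; first by rewrite big_cons.
  by rewrite /sqmod expr0n !addr0 add0r.
apply: bessel; elim: s us => //= j s IH /andP[js /IH us].
case E : (p j) => [k|] //=; rewrite us andbT mem_pmap.
apply: contra js => /mapP[i si pi].
by have /pq := E; have /pq := esym pi => -> [<-].
Qed.

Lemma pulls_lin T p : pulls T p -> linear T.
Proof.
move=> Tp c f g; apply: l2_ext => j; rewrite Tp.
change (oapp (c *: f + g) 0 (p j) = c * T f j + T g j); rewrite !Tp.
by case: (p j) => [k|] //=; rewrite mulr0 addr0.
Qed.

Lemma pulls_bd T p q : partial_inverse p q -> pulls T p -> bounded_operators V T.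
Proof.
move=> pq Tp; split; first exact: pulls_lin Tp.
by exists 1 => v; rewrite mul1r; exact: pulls_hn pq Tp.
Qed.

Lemma pulls_l2e T p q j : partial_inverse p q -> pulls T p ->
  T (l2e R j) = oapp (l2e R) 0 (q j).
Proof.
move=> pq Tp; apply: l2_ext => i; rewrite Tp.
have -> : (oapp (l2e R) 0 (q j) : V) i = (q j == Some i)%:R.
  by case: (q j) => [k|] //=; rewrite eq_sym.
have -> : oapp (l2e R j) 0 (p i) = (p i == Some j)%:R by case: (p i).
by congr (_%:R); congr nat_of_bool; apply/eqP/eqP => /pq.
Qed.

Lemma conj_semilinear (c x y : R[i]) :
  Num.conj (Num.conj c * x + y) = c * Num.conj x + Num.conj y.
Proof. by rewrite rmorphD rmorphM /= conjCK. Qed.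

Lemma pulls_adjoint T S p q : partial_inverse p q -> pulls T p -> pulls S q ->
  is_adjoint T S.
Proof.
move=> pq Tp Sq f g.
have lT := pulls_lin Tp; have lS := pulls_lin Sq.
pose F (h : V) : Cline R := Num.conj (hdot (T f) h).
pose G (h : V) : Cline R := Num.conj (hdot f (S h)).
have hnC (z : Cline R) : hn z = normc z by rewrite hnorm_cE; case: z.
have nconj z : normc (Num.conj z : R[i]) = normc z.
  by case: z => a b /=; rewrite sqrrN.
suff : F g = G g by move=> /(congr1 Num.conj); rewrite /F /G !conjCK.
apply: bd_eq_l2e.
- by move=> c u v; rewrite /F hdotDr hdotZr conj_semilinear.
- by move=> c u v; rewrite /G lS hdotDr hdotZr conj_semilinear.
- exists (hn (T f)) => [|v]; first exact: hn_ge0.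
  by rewrite hnC nconj cauchy_schwarz.
- exists (hn f) => [|v]; first exact: hn_ge0.
  rewrite hnC nconj; apply: le_trans (cauchy_schwarz _ _) _.
  by rewrite ler_wpM2l ?hn_ge0//; exact: pulls_hn (partial_inverseC pq) Sq.
- move=> j; congr Num.conj; rewrite (pulls_l2e j (partial_inverseC pq) Sq) hdot_l2e Tp.
  by case: (p j) => [k|] /=; rewrite ?hdot_l2e ?hdot0r.
Qed.

(** A finitely supported family is eventually annihilated; since coordinate
    projections are contractions, density gives the general case. *)
Lemma coord_cvg0 (T_ : nat -> V -> V) (A_ : nat -> pred J) f :
  (forall n g j, T_ n g j = if A_ n j then g j else 0) ->
  (forall j, exists N, forall n, (N <= n)%N -> ~~ A_ n j) ->
  hconverges hdot (fun n => T_ n f) 0.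
Proof.
move=> TA A0; apply/hconvergesP => e e0; have [s [us hs]] := l2_dense f e0.
have [N HN] : exists N, forall n, (N <= n)%N -> forall j, j \in s -> ~~ A_ n j.
  elim: s {us hs} => [|j s [N HN]]; first by exists 0.
  have [M HM] := A0 j; exists (maxn N M) => n; rewrite geq_max => /andP[Nn Mn] i.
  by rewrite inE => /predU1P[->|/HN]; [exact: HM|apply].
exists N => n Nn; rewrite subr0; apply: le_lt_trans hs; set g := f - _.
have Tp : pulls (T_ n) (fun j => if A_ n j then Some j else None).
  by move=> h j; rewrite TA; case: ifP.
have pq : partial_inverse (fun j => if A_ n j then Some j else None)
    (fun j => if A_ n j then Some j else None).
  by move=> i j; split; case: ifP => // h [ij]; rewrite -ij h.
suff -> : T_ n f = T_ n g by exact: pulls_hn pq Tp.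
rewrite /g (linB (pulls_lin Tp)) (lin_sum (pulls_lin Tp)) big1_seq ?subr0//.
move=> j /andP[_ /(HN n Nn) nA]; rewrite (linZ (pulls_lin Tp)).
rewrite (_ : T_ n (l2e R j) = 0) ?scaler0//; apply: l2_ext => i; rewrite TA /=.
by case: ifP => //; case: eqVneq => // ->; rewrite (negbTE nA).
Qed.

End l2_operators.

(** * Creation and annihilation operators *)

Section Fock_operators.
Variable R : realType.
Local Notation F := (Fock R).
Local Notation cre := (@creation R).
Local Notation ann := (@annihilation R).
Implicit Types (f g : F) (i j k : int) (s t : seq int) (w : word).

Lemma push_pop i : partial_inverse (pop i) (push i).
Proof. by move=> u w; split=> [/popP/pushP|/pushP/popP]. Qed.

Lemma cre_pulls i : pulls (cre i) (pop i). Proof. by []. Qed.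
Lemma ann_pulls i : pulls (ann i) (push i). Proof. by []. Qed.

Lemma bd_cre i : bounded_operators F (cre i).
Proof. exact: pulls_bd (push_pop i) (cre_pulls i). Qed.
Lemma bd_ann i : bounded_operators F (ann i).
Proof. exact: pulls_bd (partial_inverseC (push_pop i)) (ann_pulls i). Qed.
Lemma adj_cre i : is_adjoint (cre i) (ann i).
Proof. exact: pulls_adjoint (push_pop i) (cre_pulls i) (ann_pulls i). Qed.
Lemma adj_ann i : is_adjoint (ann i) (cre i).
Proof.
exact: pulls_adjoint (partial_inverseC (push_pop i)) (ann_pulls i) (cre_pulls i).
Qed.

(** Coordinates extended by zero to arbitrary sequences: this makes
    annihilation a plain substitution, see [ev_ann]. *)
Definition ev f s : R[i] := oapp f 0 (insub s : option word).

Lemma evE f w : ev f (val w) = f w. Proof. by rewrite /ev valK. Qed.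

Lemma ev_unsorted f s : ~~ sorted <%R s -> ev f s = 0.
Proof. by move=> ns; rewrite /ev insubN. Qed.

Lemma ev_ext f g : (forall s, sorted <%R s -> ev f s = ev g s) -> f = g.
Proof. by move=> fg; apply: l2_ext => w; rewrite -!evE fg//; case: w. Qed.

Lemma evD f g s : ev (f + g) s = ev f s + ev g s.
Proof. by rewrite /ev; case: insubP => [w _ _|_] //=; rewrite addr0. Qed.
Lemma evZ c f s : ev (c *: f) s = c * ev f s.
Proof. by rewrite /ev; case: insubP => [w _ _|_] //=; rewrite mulr0. Qed.
Lemma ev0 s : ev 0 s = 0.
Proof. by rewrite /ev; case: insubP. Qed.

Lemma ev_ann i f s : ev (ann i f) s = ev f (i :: s).
Proof.
rewrite [LHS]/ev; case: insubP => [w _ ws|ns] /=; first by rewrite /push ws.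
by rewrite ev_unsorted//; apply: contra ns; exact: path_sorted.
Qed.

Lemma ev_cre_nil i f : ev (cre i f) [::] = 0.
Proof. exact: (evE _ empty_word). Qed.

Lemma ev_cre_cons i f j s :
  ev (cre i f) (j :: s) = if (j == i) && path <%R j s then ev f s else 0.
Proof.
rewrite [LHS]/ev; case: insubP => [w jsw ws|ns] /=; last first.
  by case: ifP => // /andP[_ js]; rewrite /= js in ns.
rewrite /pop ws; move: (jsw) => /= ->; rewrite andbT; case: eqP => //.
Qed.

Definition above k : F -> F := ann k \o cre k.
Arguments above : simpl never.

Lemma ev_above k f s : ev (above k f) s = if path <%R k s then ev f s else 0.
Proof. by rewrite /above /= ev_ann ev_cre_cons eqxx. Qed.

Lemma bd_above k : bounded_operators F (above k).
Proof. exact: bd_comp (bd_ann k) (bd_cre k). Qed.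

Local Notation zero := (fun=> 0 : F).

Lemma lt_path_le i j s : i <= j -> path <%R j s -> path <%R i s.
Proof. by case: s => //= a s ij /andP[ja ->]; rewrite (le_lt_trans ij ja). Qed.

Lemma cre_cre0 i j : j <= i -> cre i \o cre j = zero.
Proof.
move=> ji; apply/funext => f; apply: ev_ext => -[|a s] as_ /=.
  by rewrite ev_cre_nil ev0.
rewrite ev_cre_cons ev0; case: ifP => // /andP[/eqP -> ais].
case: s ais {as_} => [|b s] /=; first by rewrite ev_cre_nil.
rewrite ev_cre_cons => /andP[ib _]; case: eqP => //= bj; lia.
Qed.

Lemma ann_ann0 i j : i <= j -> ann i \o ann j = zero.
Proof.
move=> ji; apply/funext => f; apply: ev_ext => s _ /=.
rewrite !ev_ann ev0 ev_unsorted//=.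
by rewrite negb_and; apply/orP; left; lia.
Qed.

Lemma ann_cre0 i j : i != j -> ann i \o cre j = zero.
Proof.
move=> ij; apply/funext => f; apply: ev_ext => s _ /=.
by rewrite ev_ann ev_cre_cons (negbTE ij) ev0.
Qed.

Lemma above_cre k i : k < i -> above k \o cre i = cre i.
Proof.
move=> ki; apply/funext => f; apply: ev_ext => -[|a s] /= sas.
  by rewrite ev_above /= ev_cre_nil.
rewrite ev_above ev_cre_cons /= sas !andbT.
by case: eqP => [->|_]; [rewrite ki|case: ifP].
Qed.

Lemma cre_above i k : k <= i -> cre i \o above k = cre i.
Proof.
move=> ki; apply/funext => f; apply: ev_ext => -[|a s] /= sas.
  by rewrite !ev_cre_nil.
rewrite !ev_cre_cons ev_above sas andbT; case: eqP => // ai.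
by rewrite (lt_path_le ki)// -ai.
Qed.

Lemma above_ann k i : k <= i -> above k \o ann i = ann i.
Proof.
move=> ki; apply/funext => f; apply: ev_ext => s ss /=.
rewrite ev_above ev_ann; case: ifPn => // nks.
by rewrite ev_unsorted//=; apply: contra nks; exact: lt_path_le.
Qed.

Lemma ann_above i k : k < i -> ann i \o above k = ann i.
Proof.
move=> ki; apply/funext => f; apply: ev_ext => s ss /=.
rewrite (ev_ann i f) (ev_ann i (above k f)) ev_above /= ki /=; case: ifPn => // nks.
by rewrite ev_unsorted.
Qed.

Lemma ann_above0 i k : i <= k -> ann i \o above k = zero.
Proof.
move=> ki; apply/funext => f; apply: ev_ext => s ss /=.
by rewrite ev_ann ev_above /= ltNge ki ev0.
Qed.

Lemma above_above i k : above i \o above k = above (Num.max i k).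
Proof.
apply/funext => f; apply: ev_ext => s ss /=.
rewrite !ev_above; case: s ss => [|a s] /= ss; first by [].
by rewrite gt_max ss !andbT; case: ltP; case: ltP.
Qed.

(** * Reduction of words in the generators *)

Local Notation opw := (@operator_word R).

Lemma opw_cat (u v : seq (F -> F)) : opw (u ++ v) = opw u \o opw v.
Proof. by elim: u => //= X u ->. Qed.

(** The lambda-forms of positive length and the pi-forms in a uniform shape, for
    [s] increasing and [t] decreasing. The projection [above k] in the middle
    is absorbed by its left neighbour when [k] is at most the last index of
    [s], and by its right neighbour when [k] is at most the first index of [t];
    hence [k] is arbitrary. *)
Definition generic_form s k t : F -> F :=
  opw (map cre s) \o above k \o opw (map ann t).

Definition generic_forms : set (F -> F) :=
  [set X | exists s k t,
    [/\ sorted <%R s, sorted >%R t & X = generic_form s k t]].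

Lemma cre_word_above s i k : k <= i ->
  opw (map cre (rcons s i)) \o above k = opw (map cre (rcons s i)).
Proof.
move=> ki; rewrite map_rcons -cats1 opw_cat -compA; congr (_ \o _).
exact: cre_above.
Qed.

Lemma above_ann_word k j t : k <= j ->
  above k \o opw (map ann (j :: t)) = opw (map ann (j :: t)).
Proof.
move=> kj; apply/funext => f.
exact: (congr1 (@^~ (opw (map ann t) f)) (above_ann kj)).
Qed.

Lemma sorted_rcons2 s i k : i < k -> sorted <%R (rcons s i) ->
  sorted <%R (rcons (rcons s i) k).
Proof.
case: s => [|a s] ik; first by rewrite /= ik.
by rewrite !rcons_cons /= => as_; rewrite rcons_path last_rcons ik as_.
Qed.

Lemma formsE : @positive_lambda_forms R `|` @pi_forms R = generic_forms.
Proof.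
apply/seteqP; split.
  move=> _ [[s [t [ss st st0 ->]]]|[s [k [t [ss st ->]]]]].
    rewrite opw_cat; case/lastP: s ss st0 => [|s i] ss st0.
      case: t st st0 => // j t st _; exists [::], j, (j :: t); split=> //.
      by rewrite /generic_form -compA above_ann_word.
    by exists (rcons s i), i, t; split; rewrite // /generic_form cre_word_above.
  exists s, k, t; split; [|exact: path_sorted st|by rewrite opw_cat].
  by case: s ss => //= a s; rewrite rcons_path => /andP[].
move=> _ [s [k [t [ss st ->]]]].
have [[t0 E]|kt] : ((0 < size t)%N /\
    above k \o opw (map ann t) = opw (map ann t)) \/ sorted >%R (k :: t).
- case: t st => [|j t] st; first by right.
  case: (leP k j) => kj; [left|by right => /=; rewrite kj].
  by split=> //; exact: above_ann_word.
- left; exists s, t; split; rewrite // ?addn_gt0 ?t0 ?orbT//.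
  by rewrite /generic_form -compA E opw_cat.
case/lastP: s ss => [|s i] ss; first by right; exists [::], k, t.
case: (leP k i) => ki.
  left; exists (rcons s i), t; split=> //; first by rewrite size_rcons.
  by rewrite /generic_form cre_word_above// opw_cat.
right; exists (rcons s i), k, t; split=> //; first exact: sorted_rcons2.
by rewrite opw_cat.
Qed.

(** With [ann_forms]: the generic forms are stable, up to zero, under left
    multiplication by the generators, so that their span is an algebra. *)
Lemma cre_forms i X : generic_forms X ->
  generic_forms (cre i \o X) \/ cre i \o X = zero.
Proof.
move=> [s [k [t [ss st ->]]]]; case: s ss => [|j s] ss.
  by left; exists [:: i], k, t.
case: (ltP i j) => ij; [left|right].
  by exists (i :: j :: s), k, t; split=> //=; rewrite ij.
have -> : cre i \o generic_form (j :: s) k t =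
  (cre i \o cre j) \o generic_form s k t by [].
by rewrite cre_cre0.
Qed.

Lemma ann_forms i X : generic_forms X ->
  generic_forms (ann i \o X) \/ ann i \o X = zero.
Proof.
move=> [s [k [t [ss st ->]]]]; case: s ss => [|j s] ss.
  have E : ann i \o generic_form [::] k t = (ann i \o above k) \o opw (map ann t).
    by [].
  rewrite E; case: (leP i k) => ik; first by rewrite ann_above0//; right.
  rewrite ann_above//; case: t st {E} => [|l t] st.
    left; exists [::], i, [:: i]; split=> //; rewrite /generic_form /=.
    exact/esym/above_ann.
  case: (leP i l) => il.
    right; rewrite (_ : _ \o _ = (ann i \o ann l) \o opw (map ann t))//.
    by rewrite ann_ann0.
  left; exists [::], i, (i :: l :: t); split=> //=; first by rewrite il.
  have E := above_ann (lexx i).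
  by apply/funext => f; have := congr1 (@^~ (opw (map ann (l :: t)) f)) E.
have -> : ann i \o generic_form (j :: s) k t =
  (ann i \o cre j) \o generic_form s k t by [].
have [ij|ij] := eqVneq i j; last by right; rewrite ann_cre0.
rewrite -{}ij in ss *; left; case: s ss => [|l s] ss.
  exists [::], (Num.max i k), t; split=> //.
  by rewrite /generic_form /= -above_above.
exists (l :: s), k, t; split=> //; first exact: path_sorted ss.
have il : i < l by case/andP: ss.
have -> : (ann i \o cre i) \o generic_form (l :: s) k t =
  (above i \o cre l) \o generic_form s k t by [].
by rewrite above_cre.
Qed.

End Fock_operators.
Arguments bd_cre {R} i.
Arguments bd_ann {R} i.
Arguments adj_cre {R} i.
Arguments adj_ann {R} i.

(** * Spans, norm closures and generated algebras *)

Section spans.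
Variables (R : realType) (H : hilbertType R).
Local Notation bd := (bounded_operators H).
Implicit Types (T X Y Z : H -> H) (F : set (H -> H)) (c : R[i]).

Lemma span_ind F (P : (H -> H) -> Prop) : P (fun=> 0) ->
  (forall c X Y, F X -> P Y -> P (fun v => c *: X v + Y v)) ->
  forall X, linear_span F X -> P X.
Proof.
move=> P0 PD X [n [c [Z [FZ ->]]]].
elim: n c Z FZ => [|n IH] c Z FZ.
  by move: P0; congr P; apply/funext => v; rewrite big_ord0.
have := PD (c ord0) _ _ (FZ ord0)
  (IH (c \o lift ord0) (Z \o lift ord0) (fun k => FZ _)).
by congr P; apply/funext => v; rewrite big_ord_recl.
Qed.

Lemma span0 F : linear_span F (fun=> 0).
Proof.
exists 0, (fun=> 0), (fun=> idfun); split=> [[]//|].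
by apply/funext => v; rewrite big_ord0.
Qed.

Lemma span_cons F c X Y : F X -> linear_span F Y ->
  linear_span F (fun v => c *: X v + Y v).
Proof.
move=> FX [n [d [Z [FZ ->]]]].
exists n.+1, (fun i => if unlift ord0 i is Some j then d j else c),
  (fun i => if unlift ord0 i is Some j then Z j else X); split.
  by move=> k; case: unliftP.
apply/funext => v; rewrite big_ord_recl unlift_none; congr (_ + _).
by apply: eq_bigr => i _; rewrite liftK.
Qed.

Lemma spanD F c X Y : linear_span F X -> linear_span F Y ->
  linear_span F (fun v => c *: X v + Y v).
Proof.
move=> FX FY; move: X FX; apply: span_ind => [|d X Z FX FZ].
  by move: FY; congr linear_span; apply/funext => v; rewrite scaler0 add0r.
have := span_cons (c * d) FX FZ; congr linear_span; apply/funext => v.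
by rewrite scalerDr scalerA addrA.
Qed.

Lemma span_in F X : F X -> linear_span F X.
Proof.
move=> FX; have := span_cons 1 FX (span0 F); congr linear_span.
by apply/funext => v; rewrite scale1r addr0.
Qed.

Lemma span_bd F : F `<=` bd -> linear_span F `<=` bd.
Proof.
move=> Fb; apply: span_ind; first exact: bd0.
by move=> c X Y /Fb bX bY; exact: bdD.
Qed.

Lemma norm_closureP F T : F `<=` bd -> norm_closure F T <->
  bd T /\ forall e : R, 0 < e ->
    exists2 X, F X & forall v, hn (T v - X v) <= e * hn v.
Proof.
move=> Fb; split=> -[bT h]; split=> // e e0.
  have [X FX Xe] := h _ e0; exists X => // v.
  apply: le_trans (ler_opnorm v (bdB bT (Fb _ FX))) _.
  by rewrite ler_wpM2r ?hn_ge0// ltW.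
have e2 : 0 < e / 2 by rewrite divr_gt0.
have [X FX Xe] := h _ e2; exists X => //.
by apply: le_lt_trans (opnorm_le (ltW e2) Xe) _; lra.
Qed.

Lemma adjointC X Y : is_adjoint X Y -> is_adjoint Y X.
Proof. by move=> XY u v; rewrite hdotC -XY -hdotC. Qed.

Lemma adjoint_comp X X' Y Y' : is_adjoint X X' -> is_adjoint Y Y' ->
  is_adjoint (X \o Y) (Y' \o X').
Proof. by move=> aX aY u v /=; rewrite aX aY. Qed.

Lemma adjointD c X X' Y Y' : is_adjoint X X' -> is_adjoint Y Y' ->
  is_adjoint (fun v => c *: X v + Y v) (fun v => Num.conj c *: X' v + Y' v).
Proof.
by move=> aX aY u v; rewrite hdotDl hdotDr hdotZl hdotZr conjCK aX aY.
Qed.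

Lemma adjoint_scalar c :
  is_adjoint (fun v : H => c *: v) (fun v => Num.conj c *: v).
Proof. by move=> u v; rewrite hdotZl hdotZr conjCK. Qed.

Lemma hdot_inj u v : (forall w, hdot u w = hdot v w) -> u = v :> H.
Proof.
move=> uv; apply/eqP; rewrite -subr_eq0.
by rewrite -(dnorm_eq0 (hdot : {dot H for Num.conj})) hdotBl uv subrr.
Qed.

Lemma adjoint_unique X Y Z : is_adjoint X Y -> is_adjoint X Z -> Y = Z.
Proof.
move=> XY XZ; apply/funext => v; apply: hdot_inj => w.
by rewrite hdotC [RHS]hdotC -XY -XZ.
Qed.

(** If [e] bounds [X] then the square of the norm of [Y v] is the inner product
    of [X (Y v)] with [v], hence at most [e] times the norms of [Y v] and
    [v]. *)
Lemma adjoint_bound X Y (e : R) : is_adjoint X Y ->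
  (forall v, hn (X v) <= e * hn v) -> forall v, hn (Y v) <= e * hn v.
Proof.
move=> XY Xe v; have [Y0|Yp] := leP (hn (Y v)) 0.
  have -> : hn (Y v) = 0 by apply/eqP; rewrite eq_le Y0 hn_ge0.
  have [->|v0] := eqVneq (hn v) 0; first by rewrite mulr0.
  rewrite mulr_ge0 ?hn_ge0//.
  have vp : 0 < hn v by rewrite lt_neqAle eq_sym v0 hn_ge0.
  by rewrite -(pmulr_lge0 _ vp); apply: le_trans (Xe v); rewrite hn_ge0.
have : hn (Y v) ^+ 2 <= e * hn (Y v) * hn v.
  have -> : hn (Y v) ^+ 2 = Re (hdot (X (Y v)) v) by rewrite XY hdotvv.
  apply: le_trans (ler_Re_normc _) _; apply: le_trans (cauchy_schwarz _ _) _.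
  by rewrite ler_wpM2r ?hn_ge0.
by rewrite mulrAC expr2 ler_pM2r.
Qed.

Lemma adjoint_lin X Y : is_adjoint X Y -> linear Y.
Proof.
move=> XY c u v; apply: hdot_inj => w; rewrite hdotC -XY hdotDr hdotZr !XY.
by rewrite hdotDl hdotZl conj_semilinear -!hdotC.
Qed.

Lemma adjoint_bd X Y : is_adjoint X Y -> bd X -> bd Y.
Proof.
move=> XY bX; have [M _ XM] := bd_bound bX; split; first exact: adjoint_lin XY.
by exists M; exact: adjoint_bound XY XM.
Qed.

End spans.

Section generated.
Variables (R : realType) (H : hilbertType R).
Local Notation bd := (bounded_operators H).
Implicit Types (T X Y Z : H -> H) (F G : set (H -> H)) (c : R[i]).

Lemma Cstar_generated_sub F : F `<=` Cstar_generated F.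
Proof. exact: sub_smallest. Qed.

Lemma Cstar_generated_min F G : is_Cstar_algebra G -> F `<=` G ->
  Cstar_generated F `<=` G.
Proof. by move=> CG FG; apply: smallest_sub. Qed.

Lemma Cstar_generated_algebra F G : is_Cstar_algebra G -> F `<=` G ->
  is_unital_star_algebra (Cstar_generated F).
Proof.
move=> CG FG; split.
- exact: subset_trans (Cstar_generated_min CG FG) (algebra_bounded CG.1).
- by move=> A [[sA _] _]; exact: (algebra_unit sA).
- move=> c X Y FX FY A [CA FA]; apply: (algebra_linear CA.1).
  + exact: FX.
  + exact: FY.
- move=> X Y FX FY A [CA FA]; apply: (algebra_comp CA.1).
  + exact: FX.
  + exact: FY.
- move=> X Y FX bY XY A [CA FA]; apply: (algebra_adjoint CA.1 _ bY XY).
  exact: FX.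
Qed.

Lemma vN_generated_sub F : F `<=` vN_generated F.
Proof. exact: sub_smallest. Qed.

Lemma commutant_anti F G : F `<=` G -> commutant G `<=` commutant F.
Proof. by move=> FG T [bT TG]; split=> // X /FG; exact: TG. Qed.

Lemma sub_bicommutant F : F `<=` bd -> F `<=` bicommutant F.
Proof. by move=> Fb X FX; split; [exact: Fb|move=> T [_ /(_ _ FX)]]. Qed.

Lemma commutantK F : F `<=` bd -> bicommutant (commutant F) = commutant F.
Proof.
move=> Fb; apply/seteqP; split; last first.
  by apply: sub_bicommutant => T [].
by apply: commutant_anti; exact: sub_bicommutant.
Qed.

(** Each element of the set must have an adjoint inside the set: this yields
    closure under the involution without a general existence theorem for
    adjoints. *)
Lemma commutant_vN F : F `<=` bd ->
  (forall T, F T -> exists2 T', F T' & is_adjoint T T') ->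
  is_vN_algebra (commutant F).
Proof.
move=> Fb Fs; split; last exact: commutantK.
split=> [T []//||c X Y [bX hX] [bY hY]|X Y [bX hX] [bY hY]|X Y [bX hX] bY XY].
- by split; [exact: bd_id|].
- split=> [|T FT]; first exact: bdD.
  have lT := bd_lin (Fb _ FT); apply/funext => v /=.
  have := congr1 (@^~ v) (hX _ FT); have := congr1 (@^~ v) (hY _ FT) => /= -> ->.
  by rewrite -lT.
- split=> [|T FT]; first exact: bd_comp.
  by rewrite -compA (hY _ FT) compA (hX _ FT).
- split=> // T FT; have [T' FT' TT'] := Fs _ FT.
  have h1 := adjoint_comp XY (adjointC TT').
  have h2 := adjoint_comp (adjointC TT') XY.
  by apply: (adjoint_unique h2); rewrite -(hX _ FT').
Qed.

(** The commutant of a self-adjoint set commuting with [G] is one of the von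
    Neumann algebras containing [G]. *)
Lemma vN_generated_commute F G : F `<=` bd ->
  (forall T, F T -> exists2 T', F T' & is_adjoint T T') ->
  (forall T X, F T -> G X -> bd X /\ T \o X = X \o T) ->
  F `<=` commutant (vN_generated G).
Proof.
move=> Fb Fs FG T FT; split=> [|X GX]; first exact: Fb.
have sub : G `<=` commutant F.
  move=> Y GY; split=> [|S FS]; first by have [] := FG _ _ FT GY.
  by have [_ ->] := FG _ _ FS GY.
have [_ XF] := GX _ (conj (commutant_vN Fb Fs) sub).
by rewrite (XF _ FT).
Qed.

(** Both sides are limits of one sequence: by continuity of [S], and by strong
    convergence at [S v]. *)
Lemma commute_strong_limit S T (T_ : nat -> H -> H) : bd S ->
  (forall v, hconverges hdot (fun n => T_ n v) (T v)) ->
  (exists N, forall n, (N <= n)%N -> S \o T_ n = T_ n \o S) ->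
  S \o T = T \o S.
Proof.
move=> bS TT [N ST]; apply/funext => v /=.
apply: (hconverges_unique (bd_cvg bS (TT v))).
have /hconvergesP h := TT (S v); apply/hconvergesP => e /h [M HM].
exists (maxn N M) => n; rewrite geq_max => /andP[/ST E /HM].
by have := congr1 (@^~ v) E => /= ->.
Qed.

End generated.

(** * The state at infinity *)

Section state_at_infinity.
Variable R : realType.
Local Notation F := (Fock R).
Local Notation bd := (bounded_operators F).
Local Notation cre := (@creation R).
Local Notation ann := (@annihilation R).
Local Notation opw := (@operator_word R).
Local Notation forms := (@generic_forms R).
Implicit Types (X Y Z : F -> F) (c x y : R[i]) (s t : seq int).

Lemma hn_Cline (z : Cline R) : hn z = normc z.
Proof. by rewrite hnorm_cE; case: z. Qed.

Definition letter (k : int) : word := exist (fun s => sorted <%R s) [:: k] isT.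

(** One-letter words whose letter tends to minus infinity. Every generator kills
    these vectors from some rank on, and therefore so does every form of
    positive length: on them only the scalar part of an operator survives. *)
Definition far (n : nat) : F := l2e R (letter (- n%:Z)).

Definition char_at Y c :=
  hconverges hdot (fun n => Y (far n) - c *: far n) 0.

Lemma hn_far n : hn (far n) = 1. Proof. exact: hn_l2e. Qed.

Lemma char_atP Y c : char_at Y c <-> forall e : R, 0 < e ->
  exists N, forall n, (N <= n)%N -> hn (Y (far n) - c *: far n) < e.
Proof.
split=> [/hconvergesP h e /h [N HN]|h].
  by exists N => n /HN; rewrite subr0.
by apply/hconvergesP => e /h [N HN]; exists N => n /HN; rewrite subr0.
Qed.

Lemma char_at_eventually0 Y N :
  (forall n, (N <= n)%N -> Y (far n) = 0) -> char_at Y 0.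
Proof.
move=> Y0; apply/char_atP => e e0; exists N => n /Y0 ->.
by rewrite scale0r subrr hn0.
Qed.

Lemma char_at_cre i : char_at (cre i) 0.
Proof.
apply: (@char_at_eventually0 _ `|i|%N) => n ni; rewrite creation_basis /push.
by rewrite insubN//= andbT -leNgt; lia.
Qed.

Lemma char_at_ann i : char_at (ann i) 0.
Proof.
apply: (@char_at_eventually0 _ `|i|.+1) => n ni; rewrite annihilation_basis.
by rewrite /pop /=; case: eqP => // ?; lia.
Qed.

Lemma char_at_ext X Y x y : (forall v, X v = Y v) -> x = y ->
  char_at X x -> char_at Y y.
Proof. by move=> /funext -> ->. Qed.

Lemma char_at_comp0 X Y : bd X -> char_at Y 0 -> char_at (X \o Y) 0.
Proof.
move=> bX Y0; apply: hconverges_ext (bd_cvg bX Y0) => [n /=|].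
  by rewrite !scale0r !subr0.
exact: lin0 (bd_lin bX).
Qed.

Lemma char_at_id c : char_at (fun v => c *: v) c.
Proof. by apply/char_atP => e e0; exists 0 => n _; rewrite subrr hn0. Qed.

Lemma char_at_lin c X Y x y : char_at X x -> char_at Y y ->
  char_at (fun v => c *: X v + Y v) (c * x + y).
Proof.
move=> Xx Yy.
apply: hconverges_ext (hconvergesD (bd_cvg (bd_scalar F c) Xx) Yy) => [n /=|].
  by rewrite scalerDl -scalerA opprD scalerBr addrACA.
by rewrite scaler0 addr0.
Qed.

Lemma char_at_comp X Y x y : bd X -> char_at X x -> char_at Y y ->
  char_at (X \o Y) (x * y).
Proof.
move=> bX Xx Yy.
have h := hconvergesD (bd_cvg (bd_scalar F y) Xx) (bd_cvg bX Yy).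
apply: hconverges_ext h => [n /=|].
  rewrite (linB (bd_lin bX)) (linZ (bd_lin bX)).
  by rewrite scalerBr scalerA [y * x]mulrC addrC addrA subrK.
by rewrite scaler0 (lin0 (bd_lin bX)) addr0.
Qed.

Lemma char_at_bound X x (M : R) : char_at X x ->
  (forall v, hn (X v) <= M * hn v) -> normc x <= M.
Proof.
move=> /char_atP Xx XM; rewrite leNgt; apply/negP => Mx.
have [|N /(_ _ (leqnn N))] := Xx (normc x - M); first by rewrite subr_gt0.
rewrite ltNge => /negP; apply.
have := XM (far N); rewrite hn_far mulr1 => h.
have := ler_hnB (X (far N)) (X (far N) - x *: far N).
by rewrite subKr hnZ hn_far mulr1; lra.
Qed.

Lemma char_at_unique X x y : char_at X x -> char_at X y -> x = y.
Proof.
move=> Xx Xy; apply/eqP; rewrite -subr_eq0; apply/eqP.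
apply: ComplexField.Normc.eq0_normc; apply/eqP; rewrite eq_le normc_ge0 andbT.
have h := char_at_lin (-1) Xy Xx; rewrite mulN1r addrC in h.
by apply: char_at_bound h _ => v; rewrite scaleN1r addNr hn0 mul0r.
Qed.

Lemma char_at_adjoint X Y x y : is_adjoint X Y -> char_at X x -> char_at Y y ->
  y = Num.conj x.
Proof.
move=> XY /char_atP Xx /char_atP Yy; apply/eqP; rewrite -subr_eq0; apply/eqP.
apply: ComplexField.Normc.eq0_normc; apply/eqP; rewrite eq_le normc_ge0 andbT.
rewrite leNgt; apply/negP => e0; set e := normc _ in e0.
have e2 : 0 < e / 2 by rewrite divr_gt0.
have [N HN] := Xx _ e2; have [M HM] := Yy _ e2.
have := HN _ (leq_maxl N M); have := HM _ (leq_maxr N M).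
set v := far _ => h1 h2.
have ff : hdot v v = 1 by rewrite hdotvv hn_far expr1n.
have k1 := cauchy_schwarz v (Y v - y *: v).
have k2 := cauchy_schwarz (X v - x *: v) v.
rewrite !hn_far mul1r hdotBr hdotZr ff mulr1 -XY in k1.
rewrite !hn_far mulr1 hdotBl hdotZl ff mulr1 in k2.
have E : e = normc (Num.conj y - x).
  by rewrite /e; case: (x) (y) => a b [a' b'] /=; congr Num.sqrt; ring.
have := le_normcD (hdot (X v) v - x) (- (hdot (X v) v - Num.conj y)).
rewrite normcN opprB [_ - x + _]addrC addrA subrK -E => h.
by move: h; rewrite leNgt [e]splitr ltrD// ?(le_lt_trans k2 h2) ?(le_lt_trans k1 h1).
Qed.

End state_at_infinity.

Lemma mem_eqfun (T U : Type) (P : set (T -> U)) X Y :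
  (forall v, X v = Y v) -> P X -> P Y.
Proof. by move=> /funext ->. Qed.

Section infinity_algebra.
Variable R : realType.
Local Notation F := (Fock R).
Local Notation bd := (bounded_operators F).
Local Notation cre := (@creation R).
Local Notation ann := (@annihilation R).
Local Notation opw := (@operator_word R).
Local Notation forms := (@generic_forms R).
Local Notation B := (@ideal_B R).
Implicit Types (X Y Z : F -> F) (c x y : R[i]) (s t : seq int).

Lemma bd_opw_cre s : bd (opw (map cre s)).
Proof. by elim: s => [|i s IH] /=; [exact: bd_id|exact: bd_comp (bd_cre i) IH]. Qed.
Lemma bd_opw_ann s : bd (opw (map ann s)).
Proof. by elim: s => [|i s IH] /=; [exact: bd_id|exact: bd_comp (bd_ann i) IH]. Qed.

Lemma bd_generic_form s k t : bd (@generic_form R s k t).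
Proof.
exact: bd_comp (bd_comp (bd_opw_cre s) (bd_above _ k)) (bd_opw_ann t).
Qed.

Lemma forms_bd : forms `<=` bd.
Proof. by move=> _ [s [k [t [_ _ ->]]]]; exact: bd_generic_form. Qed.

(** The lambda- and pi-forms are traded for the generic ones, and the operator
    norm for pointwise bounds. *)
Lemma ideal_BP X : B X <-> bd X /\ forall e : R, 0 < e ->
  exists2 Z, linear_span forms Z & forall v, hn (X v - Z v) <= e * hn v.
Proof.
rewrite /ideal_B formsE; apply: norm_closureP.
exact: span_bd forms_bd.
Qed.

Lemma ideal_B_span X : linear_span forms X -> B X.
Proof.
move=> sX; apply/ideal_BP; split; first exact: span_bd forms_bd _ sX.
by move=> e e0; exists X => // v; rewrite subrr hn0 mulr_ge0 ?hn_ge0// ltW.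
Qed.

Lemma span_lcomp (g : F -> F) X : linear g ->
  (forall Z, forms Z -> forms (g \o Z) \/ g \o Z = fun=> 0) ->
  linear_span forms X -> linear_span forms (g \o X).
Proof.
move=> lg gf; move: X; apply: span_ind.
  by rewrite (_ : _ \o _ = fun=> 0); [exact: span0|
    apply/funext => v /=; rewrite (lin0 lg)].
move=> c X Y /gf gX gY.
rewrite (_ : g \o _ = fun v => c *: (g \o X) v + (g \o Y) v); last first.
  by apply/funext => v /=; rewrite lg.
apply: spanD gY; case: gX => [|->]; [exact: span_in|exact: span0].
Qed.

(** A form is a word in the generators, which are moved one by one to the right
    factor. *)
Lemma span_comp X Y : linear_span forms X -> linear_span forms Y ->
  linear_span forms (X \o Y).
Proof.
move=> sX sY; move: X sX; apply: span_ind.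
  by rewrite (_ : _ \o Y = fun=> 0); [exact: span0|apply/funext].
move=> c X Z [s [k [t [_ _ ->]]]] sZ; apply: (spanD c _ sZ).
have cs i W : linear_span forms W -> linear_span forms (cre i \o W).
  by apply: span_lcomp; [exact: bd_lin (bd_cre i)|exact: cre_forms].
have as_ i W : linear_span forms W -> linear_span forms (ann i \o W).
  by apply: span_lcomp; [exact: bd_lin (bd_ann i)|exact: ann_forms].
have h : linear_span forms (opw (map ann t) \o Y).
  by elim: t => //= i t; exact: as_.
have {}h : linear_span forms (ann k \o (cre k \o (opw (map ann t) \o Y))).
  exact/as_/cs.
have : linear_span forms (opw (map cre s) \o
    (ann k \o (cre k \o (opw (map ann t) \o Y)))).
  by elim: s => //= i s; exact: cs.
by [].
Qed.

Lemma adj_opw_cre s : is_adjoint (opw (map cre s)) (opw (map ann (rev s))).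
Proof.
elim: s => [|i s IH]; first by [].
rewrite rev_cons map_rcons -cats1 opw_cat.
exact: adjoint_comp (adj_cre i) IH.
Qed.

Lemma adj_above k : is_adjoint (@above R k) (@above R k).
Proof. exact: adjoint_comp (adj_ann k) (adj_cre k). Qed.

Lemma adj_generic_form s k t :
  is_adjoint (@generic_form R s k t) (@generic_form R (rev t) k (rev s)).
Proof.
have h := adjointC (adj_opw_cre (rev t)); rewrite revK in h.
exact: adjoint_comp (adjoint_comp (adj_opw_cre s) (adj_above k)) h.
Qed.

Lemma span_adjoint X : linear_span forms X ->
  exists2 Y, linear_span forms Y & is_adjoint X Y.
Proof.
move: X; apply: span_ind.
  exists (fun=> 0); first exact: span0.
  by move=> u v; rewrite hdot0l hdot0r.
move=> c X Y [s [k [t [ss st ->]]]] [Y' sY' YY'].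
exists (fun v => Num.conj c *: @generic_form R (rev t) k (rev s) v + Y' v).
  apply: span_cons sY'; exists (rev t), k, (rev s); split=> //.
  - by rewrite rev_sorted.
  - by rewrite rev_sorted.
exact: adjointD (adj_generic_form s k t) YY'.
Qed.

Lemma ideal_B_lin c X Y : B X -> B Y -> B (fun v => c *: X v + Y v).
Proof.
move=> /ideal_BP[bX hX] /ideal_BP[bY hY]; apply/ideal_BP; split; first exact: bdD.
move=> e e0; have e2 : 0 < e / 2 by rewrite divr_gt0.
have [d0 dc] := eps_div (normc_ge0 c) e2.
have [X' sX' XX'] := hX _ d0; have [Y' sY' YY'] := hY _ e2.
exists (fun v => c *: X' v + Y' v); first exact: spanD.
move=> v; rewrite opprD addrACA -scalerBr; apply: le_trans (ler_hnD _ _) _.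
rewrite hnZ [leRHS](_ : _ = e / 2 * hn v + e / 2 * hn v); last first.
  by rewrite -mulrDl -splitr.
apply: lerD => //.
apply: (@le_trans _ _ (normc c * (e / 2 / (normc c + 1) * hn v))).
  by rewrite ler_wpM2l ?normc_ge0.
by rewrite mulrA ler_wpM2r ?hn_ge0// ltW.
Qed.

Lemma ideal_B_comp X Y : B X -> B Y -> B (X \o Y).
Proof.
move=> /ideal_BP[bX hX] /ideal_BP[bY hY]; apply/ideal_BP; split; first exact: bd_comp.
move=> e e0; have e2 : 0 < e / 2 by rewrite divr_gt0.
have [M M0 XM] := bd_bound bX; have [d0 dM] := eps_div M0 e2.
have [Y' sY' YY'] := hY _ d0.
have [N N0 YN] := bd_bound (span_bd forms_bd sY').
have [d'0 dN] := eps_div N0 e2; have [X' sX' XX'] := hX _ d'0.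
exists (X' \o Y'); first exact: span_comp.
move=> v /=.
have -> : X (Y v) - X' (Y' v) = X (Y v - Y' v) + (X (Y' v) - X' (Y' v)).
  by rewrite (linB (bd_lin bX)) addrA subrK.
apply: le_trans (ler_hnD _ _) _.
rewrite [leRHS](_ : _ = e / 2 * hn v + e / 2 * hn v); last first.
  by rewrite -mulrDl -splitr.
apply: lerD.
  apply: le_trans (XM _) _; apply: le_trans (ler_wpM2l M0 (YY' v)) _.
  by rewrite mulrA ler_wpM2r ?hn_ge0// ltW.
apply: le_trans (XX' _) _; apply: le_trans (ler_wpM2l (ltW d'0) (YN v)) _.
by rewrite mulrA ler_wpM2r ?hn_ge0// mulrC ltW.
Qed.

Lemma ideal_B_adjoint X Y : B X -> is_adjoint X Y -> B Y.
Proof.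
move=> /ideal_BP[bX hX] XY; apply/ideal_BP; split; first exact: adjoint_bd XY bX.
move=> e e0; have [Z sZ XZ] := hX _ e0; have [Z' sZ' ZZ'] := span_adjoint sZ.
exists Z' => // v.
have XZa := adjointD (-1) ZZ' XY.
have := adjoint_bound XZa _ v; rewrite rmorphN1 scaleN1r addrC; apply.
by move=> w; rewrite scaleN1r addrC.
Qed.

(** The rightmost generator of a form already kills [far n] for large [n]; the
    bound in the closure is uniform over these unit vectors. *)
Lemma char_at_ideal_B X : B X -> char_at X 0.
Proof.
have spanc Z : linear_span forms Z -> char_at Z 0.
  move: Z; apply: span_ind => [|c Z Y [s [k [t [_ _ ->]]]] Y0].
    by apply: (@char_at_eventually0 _ _ 0).
  have h : char_at (@generic_form R s k t) 0.
    case/lastP: t => [|t i].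
      have h := char_at_comp0 (bd_comp (bd_opw_cre s) (bd_ann k)) (char_at_cre k).
      exact: h.
    rewrite /generic_form map_rcons -cats1 opw_cat compA.
    by apply: char_at_comp0 (char_at_ann i); exact: (bd_generic_form s k t).
  by have := char_at_lin c h Y0; rewrite mulr0 addr0.
move=> /ideal_BP[bX hX]; apply/char_atP => e e0.
have e2 : 0 < e / 2 by rewrite divr_gt0.
have [Z sZ XZ] := hX _ e2; have /char_atP/(_ _ e2)[N HN] := spanc _ sZ.
exists N => n /HN; rewrite !scale0r !subr0 => h.
rewrite -[X _](subrK (Z (@far R n))); apply: le_lt_trans (ler_hnD _ _) _.
have := XZ (@far R n); rewrite hn_far mulr1 => h'.
by rewrite [e]splitr ler_ltD.
Qed.

(** A C*-algebra that contains the annihilation operators, hence the monotone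
    algebra. *)
Definition infinity_algebra : set (F -> F) :=
  [set Y | exists c, B (fun v => Y v - c *: v)].

Lemma infinity_intro X c : B X -> infinity_algebra (fun v => X v + c *: v).
Proof. by move=> BX; exists c; under eq_fun do rewrite addrK. Qed.

Lemma infinity_elim Y : infinity_algebra Y ->
  exists X c, B X /\ Y = fun v => X v + c *: v.
Proof.
move=> [c Bc]; exists (fun v => Y v - c *: v), c; split=> //.
by apply/funext => v; rewrite subrK.
Qed.

Lemma infinity_char Y c : B (fun v => Y v - c *: v) -> char_at Y c.
Proof.
move=> /char_at_ideal_B h.
apply: char_at_ext (char_at_lin 1 (char_at_id c) h) => [v|].
  by rewrite scale1r addrC subrK.
by rewrite mul1r addr0.
Qed.

Lemma infinity_bd : infinity_algebra `<=` bd.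
Proof.
move=> _ /infinity_elim[X [c [/ideal_BP[bX _] ->]]].
by apply: mem_eqfun (bdD c (@bd_id _ _) bX) => v /=; rewrite addrC.
Qed.

Lemma ideal_B0 : B (fun=> 0). Proof. exact/ideal_B_span/span0. Qed.

Lemma infinity_star_algebra : is_unital_star_algebra infinity_algebra.
Proof.
split; first exact: infinity_bd.
- exists 1; apply: mem_eqfun ideal_B0 => v /=.
  by rewrite scale1r subrr.
- move=> c _ _ /infinity_elim[X [x [BX ->]]] /infinity_elim[Y [y [BY ->]]].
  apply: mem_eqfun (infinity_intro (c * x + y) (ideal_B_lin c BX BY)) => v.
  by rewrite scalerDr scalerDl scalerA addrACA.
- move=> _ _ /infinity_elim[X [x [BX ->]]] /infinity_elim[Y [y [BY ->]]].
  have [/ideal_BP[bX _] /ideal_BP[bY _]] := (BX, BY).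
  have h := ideal_B_lin y BX (ideal_B_lin x BY (ideal_B_comp BX BY)).
  apply: mem_eqfun (infinity_intro (x * y) h) => v /=.
  rewrite (linD (bd_lin bX)) (linZ (bd_lin bX)) scalerDr scalerA.
  by rewrite [x *: Y v + _]addrC addrA [y *: X v + _]addrC -!addrA.
- move=> _ Y /infinity_elim[X [x [BX ->]]] _ XY.
  have aD := adjointD 1 XY (@adjoint_scalar R F (- x)).
  exists (Num.conj x); apply: (@ideal_B_adjoint X) => // u v.
  have := aD u v; rewrite scale1r scaleNr addrK => ->.
  by rewrite rmorph1 scale1r rmorphN /= scaleNr.
Qed.

(** The scalar part of an operator is at most its norm, by [char_at_bound].
    Hence the scalar parts of approximating operators form a Cauchy sequence,
    and their limit is the scalar part of the limit. *)
Lemma infinity_closed : norm_closure infinity_algebra `<=` infinity_algebra.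
Proof.
move=> Y /(norm_closureP _ infinity_bd)[bY hY].
pose d (n : nat) : R := n.+1%:R^-1; have d0 n : 0 < d n by rewrite invr_gt0 ltr0n.
(* The errors [d n] tend to zero; [Zc n] pairs the [n]-th approximating
   operator with its scalar part. *)
have approx n : exists Zc : (F -> F) * R[i],
    B (fun v => Zc.1 v - Zc.2 *: v) /\
    forall v, hn (Y v - Zc.1 v) <= d n * hn v.
  by have [Z [c Bc] h] := hY _ (d0 n); exists (Z, c).
have [Zc HZ] := choice approx.
have dN (e : R) : 0 < e -> exists N, forall n, (N <= n)%N -> d n < e.
  move=> e0; exists (Num.truncn e^-1) => n Nn.
  rewrite /d -[e]invrK ltf_pV2 ?posrE ?ltr0n ?invr_gt0//.
  have := truncnS_gt e^-1; move/lt_le_trans; apply; rewrite ler_nat ltnS//.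
have cc m n : normc ((Zc m).2 - (Zc n).2) <= d m + d n.
  have h := char_at_lin (-1) (infinity_char (HZ n).1) (infinity_char (HZ m).1).
  rewrite mulN1r addrC in h; apply: char_at_bound h _ => v.
  have -> : -1 *: (Zc n).1 v + (Zc m).1 v = (Y v - (Zc n).1 v) - (Y v - (Zc m).1 v).
    by rewrite scaleN1r opprB [RHS]addrC addrA subrK addrC.
  rewrite mulrDl [leRHS]addrC; apply: le_trans (ler_hnB _ _) _.
  by rewrite lerD// (HZ _).2.
have [c cl] : exists c : Cline R, hconverges hdot (fun n => (Zc n).2 : Cline R) c.
  apply: hilbert_complete => e e0; have e2 : 0 < e / 2 by rewrite divr_gt0.
  have [N HN] := dN _ e2; exists N => m n /HN h1 /HN h2.
  have -> : hnorm hdot ((Zc m).2 - (Zc n).2 : Cline R) = normc ((Zc m).2 - (Zc n).2).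
    exact: hn_Cline.
  apply: le_lt_trans (cc m n) _; rewrite [e]splitr ltrD//.
exists c; apply/ideal_BP; split.
  apply: mem_eqfun (bdD (- (c : R[i])) (@bd_id _ _) bY) => v /=.
  by rewrite scaleNr addrC.
move=> e e0; have e3 : 0 < e / 3 by rewrite divr_gt0.
have [N HN] := dN _ e3; have /hconvergesP/(_ _ e3)[M HM] := cl.
have {}HN := HN _ (leq_maxl N M); have {}HM := HM _ (leq_maxr N M).
set n := maxn N M in HN HM; have [/ideal_BP[_ hX] Yn] := HZ n.
have [X sX Xn] := hX _ e3; exists X => // v.
have cn : normc ((Zc n).2 - c) < e / 3.
  by have := HM; rewrite (hn_Cline ((Zc n).2 - c)).
have -> : Y v - c *: v - X v = (Y v - (Zc n).1 v) +
  ((Zc n).1 v - (Zc n).2 *: v - X v) + ((Zc n).2 - c) *: v.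
  rewrite scalerBl; move: (Y v) ((Zc n).1 v) (X v) ((Zc n).2 *: v) (_ *: v).
  move=> a b r q p.
  by rewrite !addrA subrK [_ - r + q]addrAC subrK addrAC.
apply: le_trans (ler_hnD _ _) _; apply: le_trans (lerD (ler_hnD _ _) (lexx _)) _.
rewrite hnZ.
have h1 := Yn v; have h2 := Xn v.
have h3 : normc ((Zc n).2 - c) * hn v <= e / 3 * hn v.
  by rewrite ler_wpM2r ?hn_ge0// ltW.
have h4 : d n * hn v <= e / 3 * hn v by rewrite ler_wpM2r ?hn_ge0// ltW.
have -> : e * hn v = e / 3 * hn v + e / 3 * hn v + e / 3 * hn v by lra.
by rewrite !lerD// (le_trans h1).
Qed.

Local Notation M := (@monotone_algebra R).

Lemma ann_infinity : range ann `<=` infinity_algebra.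
Proof.
move=> _ [i _ <-]; exists 0; apply: ideal_B_span; apply: span_in.
rewrite -formsE; left; exists [::], [:: i]; split=> //.
by apply/funext => v /=; rewrite scale0r subr0.
Qed.

Lemma infinity_Cstar : is_Cstar_algebra infinity_algebra.
Proof. by split; [exact: infinity_star_algebra|exact: infinity_closed]. Qed.

Lemma M_algebra : is_unital_star_algebra M.
Proof. exact: Cstar_generated_algebra infinity_Cstar ann_infinity. Qed.

(** The decomposition that defines the state exists because the monotone
    algebra is contained in [infinity_algebra]; its scalar part is then read
    off from the values at the vectors [far n]. *)
Lemma stateP Y : M Y -> char_at Y (state_at_infinity Y).
Proof.
move=> MY; have [c Bc] := Cstar_generated_min infinity_Cstar ann_infinity MY.
apply: infinity_char.
by have := @xgetPex _ 0 [set c | B (fun v => Y v - c *: v)] (ex_intro _ c Bc).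
Qed.

Lemma state_char Y c : M Y -> char_at Y c -> state_at_infinity Y = c.
Proof. by move=> /stateP; exact: char_at_unique. Qed.

End infinity_algebra.

(** * The monotone algebra *)

Section monotone_algebra.
Variable R : realType.
Local Notation F := (Fock R).
Local Notation bd := (bounded_operators F).
Local Notation cre := (@creation R).
Local Notation ann := (@annihilation R).
Local Notation opw := (@operator_word R).
Local Notation M := (@monotone_algebra R).
Local Notation P := (@vacuum_projection R).
Local Notation vac := (vacuum R).
Implicit Types (X Y Z T : F -> F) (f : F) (c : R[i]) (s : seq int) (w : word).

Lemma M_bd : M `<=` bd. Proof. exact: algebra_bounded (M_algebra R). Qed.

Lemma M_id : M idfun. Proof. exact: algebra_unit (M_algebra R). Qed.

Lemma M_comp X Y : M X -> M Y -> M (X \o Y).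
Proof. exact: algebra_comp (M_algebra R) X Y. Qed.

Lemma M_lin c X Y : M X -> M Y -> M (fun v => c *: X v + Y v).
Proof. exact: algebra_linear (M_algebra R) c X Y. Qed.

Lemma M0 : M (fun=> 0).
Proof. by apply: mem_eqfun (M_lin (-1) M_id M_id) => v; rewrite scaleN1r addNr. Qed.

Lemma MZ c X : M X -> M (fun v => c *: X v).
Proof. by move=> MX; apply: mem_eqfun (M_lin c MX M0) => v; rewrite addr0. Qed.

Lemma MD X Y : M X -> M Y -> M (fun v => X v + Y v).
Proof. by move=> MX MY; apply: mem_eqfun (M_lin 1 MX MY) => v; rewrite scale1r. Qed.

Lemma M_ann i : M (ann i). Proof. by apply: Cstar_generated_sub; exists i. Qed.

Lemma M_cre i : M (cre i).
Proof. exact: (algebra_adjoint (M_algebra R) (M_ann i) (bd_cre i) (adj_ann i)). Qed.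

Lemma M_opw_cre s : M (opw (map cre s)).
Proof. by elim: s => [|i s IH]; [exact: M_id|exact: M_comp (M_cre i) IH]. Qed.

Lemma state_lin c X Y : M X -> M Y ->
  state_at_infinity (fun v => c *: X v + Y v) =
  c * state_at_infinity X + state_at_infinity Y.
Proof.
move=> MX MY; apply: state_char (M_lin c MX MY) _.
exact: char_at_lin (stateP MX) (stateP MY).
Qed.

Lemma state_comp X Y : M X -> M Y ->
  state_at_infinity (X \o Y) = state_at_infinity X * state_at_infinity Y.
Proof.
move=> MX MY; apply: state_char (M_comp MX MY) _.
exact: char_at_comp (M_bd MX) (stateP MX) (stateP MY).
Qed.

Lemma state_adjoint X Y : M X -> M Y -> is_adjoint X Y ->
  state_at_infinity Y = Num.conj (state_at_infinity X).
Proof. by move=> MX MY XY; apply: char_at_adjoint XY (stateP MX) (stateP MY). Qed.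

Lemma state_scalar c : state_at_infinity (fun v : F => c *: v) = c.
Proof. exact: state_char (MZ c M_id) (char_at_id c). Qed.

Lemma state_id : state_at_infinity (@idfun F) = 1.
Proof.
rewrite -[RHS]state_scalar; congr state_at_infinity; apply/funext => v.
by rewrite scale1r.
Qed.

Lemma state_ann i : state_at_infinity (ann i) = 0.
Proof. exact: state_char (M_ann i) (char_at_ann i). Qed.

Lemma state_cre i : state_at_infinity (cre i) = 0.
Proof. exact: state_char (M_cre i) (char_at_cre i). Qed.

Lemma M_above k : M (@above R k). Proof. exact: M_comp (M_ann k) (M_cre k). Qed.

Lemma state_above k : state_at_infinity (@above R k) = 0.
Proof. by rewrite state_comp ?state_ann ?mul0r//; [exact: M_ann|exact: M_cre]. Qed.

(** * The vacuum vector *)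

Lemma hdot_vac f : hdot f vac = ev f [::].
Proof. by rewrite hdot_l2e -evE. Qed.

Lemma ev_vac s : ev vac s = (s == [::])%:R.
Proof.
have [ss|ns] := boolP (sorted <%R s); last first.
  by rewrite ev_unsorted//; case: s ns.
by rewrite (evE vac (exist _ s ss)).
Qed.

Lemma ev_P f s : ev (P f) s = if s == [::] then ev f s else 0.
Proof.
rewrite /vacuum_projection evZ ev_vac hdot_vac.
by case: eqP => [->|_]; rewrite ?mulr1 ?mulr0.
Qed.

Lemma bd_P : bd P.
Proof.
split.
  by move=> c u v; rewrite /vacuum_projection hdotDl hdotZl scalerDl scalerA.
exists 1 => v; rewrite /vacuum_projection hnZ hn_l2e mulr1 mul1r.
by apply: le_trans (cauchy_schwarz _ _) _; rewrite hn_l2e mulr1.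
Qed.

Lemma ann_vac i : ann i vac = 0.
Proof. by apply: ev_ext => s _; rewrite ev_ann ev_vac ev0. Qed.

Lemma above_vac k : above k vac = vac.
Proof.
by apply: ev_ext => s _; rewrite ev_above ev_vac; case: s => //= a s; rewrite if_same.
Qed.

(** The coordinate of [f] at [i :: s] is the coordinate of [ann i f] at [s]. *)
Lemma ann_all0 f : (forall i, ann i f = 0) -> f = ev f [::] *: vac.
Proof.
move=> f0; apply: ev_ext => -[|i s] _; rewrite evZ ev_vac ?mulr1//=.
by rewrite -ev_ann f0 ev0 mulr0.
Qed.

Lemma cre_word_vac w : opw (map cre (val w)) vac = l2e R w.
Proof.
case: w => s; elim: s => [|i s IH] ss /=.
  by congr l2e; apply/val_inj.
have ss' := path_sorted ss; rewrite (IH ss') creation_basis.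
by rewrite (proj2 (pushP i (exist _ (i :: s) ss) (exist _ s ss'))).
Qed.

(** [T] commutes with the creation operators, so it is determined by its value
    at the vacuum, and that value is killed by all annihilation operators. *)
Lemma commutant_scalar T : bd T -> (forall i, T \o ann i = ann i \o T) ->
  (forall i, T \o cre i = cre i \o T) -> exists c, T = fun v => c *: v.
Proof.
move=> bT Ta Tc; have [c Tv] : exists c, T vac = c *: vac.
  exists (ev (T vac) [::]); apply: ann_all0 => i.
  have := congr1 (@^~ vac) (Ta i) => /= <-.
  by rewrite ann_vac (lin0 (bd_lin bT)).
have Tw s v : T (opw (map cre s) v) = opw (map cre s) (T v).
  elim: s => //= i s <-.
  by have := congr1 (@^~ (opw (map cre s) v)) (Tc i).
exists c; apply/funext; apply: bd_eq_l2e.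
- exact: bd_lin bT.
- exact: bd_lin (bd_scalar F _).
- exact: bd_bound bT.
- exact: bd_bound (bd_scalar F _).
- by move=> w; rewrite -cre_word_vac Tw Tv (linZ (bd_lin (bd_opw_cre _ (val w)))).
Qed.

(** * Samples of the process *)

Definition head_below (j : int) s := if s is a :: _ then a < j else false.

Lemma ev_num k f s : sorted <%R s ->
  ev (cre k (ann k f)) s = if s is a :: _ then if a == k then ev f s else 0 else 0.
Proof.
case: s => [|a s] ss; first by rewrite ev_cre_nil.
by rewrite ev_cre_cons ev_ann; move: ss => /= ->; rewrite andbT; case: eqP => [->|].
Qed.

(** The projection onto the words whose first letter is less than [j]: from the
    identity one removes the words with all letters greater than [j], the
    empty word included, and those starting with [j]. *)
Definition not_above j (v : F) : F := v - above j v - cre j (ann j v).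

Lemma bd_not_above j : bd (not_above j).
Proof.
exact: bdB (bdB (@bd_id _ _) (@bd_above R j)) (bd_comp (bd_cre j) (bd_ann j)).
Qed.

Lemma evB f g s : ev (f - g) s = ev f s - ev g s.
Proof. by rewrite -scaleN1r evD evZ mulN1r. Qed.

Lemma ev_not_above j f s : sorted <%R s ->
  ev (not_above j f) s = if head_below j s then ev f s else 0.
Proof.
move=> ss; rewrite /not_above !evB ev_num// ev_above.
case: s ss => [|a s] ss /=; first by rewrite subr0 subrr.
move: ss => /= ->; rewrite andbT.
by case: ltgtP => _; rewrite ?subr0 ?subrr ?subr0.
Qed.

Lemma int_window (a j : int) n :
  (a < j) && ~~ (a < j - n.+1%:Z) =
  (a == j - n.+1%:Z) || (a < j) && ~~ (a < j - n%:Z).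
Proof. lia. Qed.

Lemma int_window0 (j : int) n :
  (j - n.+1%:Z < j) && ~~ (j - n.+1%:Z < j - n%:Z) = false.
Proof. lia. Qed.

Lemma ev_sum_num j n f s : sorted <%R s ->
  ev (\sum_(m < n) cre (j - m.+1%:Z) (ann (j - m.+1%:Z) f)) s =
  if head_below j s && ~~ head_below (j - n%:Z) s then ev f s else 0.
Proof.
move=> ss; elim: n => [|n IH].
  by rewrite big_ord0 ev0 subr0 andbN.
rewrite big_ord_recr /= evD IH ev_num//; case: s ss {IH} => [|a s] ss /=.
  by rewrite addr0.
rewrite int_window; case: eqP => [->|_]; last by rewrite addr0.
by rewrite int_window0 add0r.
Qed.

Lemma coord_small (D_ : nat -> F -> F) (A_ : nat -> seq int -> bool) :
  (forall n f s, sorted <%R s -> ev (D_ n f) s = if A_ n s then ev f s else 0) ->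
  (forall s, exists N, forall n, (N <= n)%N -> ~~ A_ n s) ->
  forall f (e : R), 0 < e -> exists N, forall n, (N <= n)%N -> hn (D_ n f) < e.
Proof.
move=> DA A0 f e e0.
have DA' n (g : l2 R word) (w : word) :
    (D_ n g : F) w = if A_ n (val w) then g w else 0.
  by rewrite -(evE (D_ n g)) DA; [rewrite evE|case: w].
have /hconvergesP/(_ e e0)[N HN] :=
  @coord_cvg0 R word D_ (fun n w => A_ n (val w)) f DA' (fun w => A0 (val w)).
by exists N => n /HN; rewrite subr0.
Qed.

(** The terms of the sum project onto the words starting with [j - 1], [j - 2]
    and so on; the [n]-th remainder projects onto the words starting below
    [j - n], and it tends strongly to zero. *)
Lemma sum_belowE j : @sum_below R j = not_above j.
Proof.
set S := [set T | bd T /\ forall v, hconverges hdot (fun n =>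
  \sum_(m < n) cre (j - m.+1%:Z) (ann (j - m.+1%:Z) v)) (T v)].
have Sj : S (not_above j).
  split; first exact: bd_not_above.
  move=> v; apply/hconvergesP => e e0.
  have [] := @coord_small (fun n f => not_above j f -
    \sum_(m < n) cre (j - m.+1%:Z) (ann (j - m.+1%:Z) f))
    (fun n => head_below (j - n%:Z)) _ _ v e e0.
  - move=> n f s ss; rewrite evB ev_sum_num// ev_not_above//.
    case: s ss => [|a s] ss /=; first by rewrite subrr.
    case: (ltP a j) => aj /=; last first.
      by rewrite subrr (_ : (a < _) = false)//; lia.
    by case: (a < _); rewrite /= ?subrr ?subr0.
  - move=> [|a s]; first by exists 0.
    by exists `|j - a|%N => n /= hn; lia.
  - by move=> N HN; exists N => n /HN; rewrite hnBC.
have [_ h] : S (@sum_below R j) by apply: (@xgetPex _ _ S); exists (not_above j).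
by apply/funext => v; apply: hconverges_unique (h v) (Sj.2 v).
Qed.

(** A nonempty word survives [above n] only while [n] is less than its first
    letter. *)
Lemma above_cvg f : hconverges hdot (fun n => above n%:Z f) (P f).
Proof.
apply/hconvergesP; apply: (@coord_small (fun n g => above n%:Z g - P g)
  (fun n s => (s != [::]) && path <%R n%:Z s)) => [n g s ss|s].
  rewrite evB ev_above ev_P; case: s ss => [|a s] ss /=; first by rewrite subrr.
  by rewrite subr0.
case: s => [|a s]; first by exists 0.
by exists `|a|%N => n /= hn; rewrite negb_and; apply/orP; left; lia.
Qed.

Lemma sum_below_cvg f : hconverges hdot (fun n => sum_below (- n%:Z) f) 0.
Proof.
apply/hconvergesP; apply: (@coord_small (fun n g => sum_below (- n%:Z) g - 0)
  (fun n => head_below (- n%:Z))) => [n g s ss|s].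
  by rewrite subr0 sum_belowE ev_not_above.
case: s => [|a s]; first by exists 0.
by exists `|a|%N => n /= hn; lia.
Qed.

Lemma M_sum_below j : M (@sum_below R j).
Proof.
rewrite sum_belowE.
have h := M_comp (M_cre j) (M_ann j).
apply: mem_eqfun (M_lin (-1) h (M_lin (-1) (M_above j) M_id)) => v.
by rewrite /not_above /= !scaleN1r addrC [- _ + v]addrC.
Qed.

Lemma state_sum_below j : state_at_infinity (@sum_below R j) = 1.
Proof.
have h := M_comp (M_cre j) (M_ann j).
have E : @sum_below R j = fun v => -1 *: (cre j \o ann j) v +
    ((-1) *: above j v + idfun v).
  apply/funext => v; rewrite sum_belowE /not_above /= !scaleN1r.
  by rewrite addrC [- _ + v]addrC.
rewrite E (state_lin (-1) h (M_lin (-1) (M_above j) M_id)).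
rewrite (state_lin (-1) (M_above j) M_id) (state_comp (M_cre j) (M_ann j)).
by rewrite state_id state_above state_ann !mulr0 !add0r.
Qed.

Definition sample j (x : 'M[R[i]]_2 * R[i]) (v : F) : F :=
  x.1 0 0 *: ann j (cre j v) + x.1 0 1 *: ann j v + x.1 1 0 *: cre j v
  + x.1 1 1 *: cre j (ann j v) + x.2 *: sum_below j v.

Lemma processE (H : hilbertType R) (pi : (F -> F) -> H -> H) j x :
  process pi j x = pi (sample j x).
Proof. by []. Qed.

Lemma M_sample j x : M (sample j x).
Proof.
have h1 := M_comp (M_ann j) (M_cre j); have h2 := M_comp (M_cre j) (M_ann j).
exact: (MD (MD (MD (MD (MZ _ h1) (MZ _ (M_ann j))) (MZ _ (M_cre j))) (MZ _ h2))
  (MZ _ (M_sum_below j))).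
Qed.

Lemma sample_above j : sample j (delta_mx 0 0, 0) = above j.
Proof.
by apply/funext => v; rewrite /sample !mxE /= scale1r !scale0r !addr0.
Qed.

Lemma sample_sum_below j : sample j (0, 1) = @sum_below R j.
Proof.
by apply/funext => v; rewrite /sample !mxE /= scale1r !scale0r !add0r.
Qed.

Lemma state_sample j x : state_at_infinity (sample j x) = x.2.
Proof.
apply: state_char (M_sample j x) _.
have h1 := M_comp (M_ann j) (M_cre j); have h2 := M_comp (M_cre j) (M_ann j).
have c5 := char_at_lin x.2 (stateP (M_sum_below j)) (stateP M0).
have c4 := char_at_lin (x.1 1 1) (stateP h2) c5.
have c3 := char_at_lin (x.1 1 0) (stateP (M_cre j)) c4.
have c2 := char_at_lin (x.1 0 1) (stateP (M_ann j)) c3.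
have c1 := char_at_lin (x.1 0 0) (stateP h1) c2.
have s0 : state_at_infinity (fun=> 0 : F) = 0.
  rewrite -[RHS]state_scalar; congr state_at_infinity; apply/funext => v.
  by rewrite scale0r.
apply: char_at_ext c1 => [v|]; first by rewrite /= addr0 !addrA.
rewrite (state_comp (M_ann j) (M_cre j)) (state_comp (M_cre j) (M_ann j)).
rewrite state_ann state_cre state_sum_below s0.
by rewrite !(mulr0, mul0r, add0r, addr0, mulr1).
Qed.

Lemma sample_commute T j x : linear T -> T \o ann j = ann j \o T ->
  T \o cre j = cre j \o T -> T \o sample j x = sample j x \o T.
Proof.
move=> lT Ta Tc.
have ta v : T (ann j v) = ann j (T v) by have := congr1 (@^~ v) Ta.
have tc v : T (cre j v) = cre j (T v) by have := congr1 (@^~ v) Tc.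
apply/funext => v; rewrite /sample sum_belowE /not_above /above /=.
by rewrite !(linD lT, linZ lT, linN lT, ta, tc).
Qed.

End monotone_algebra.

(** * Operators commuting with all but finitely many of the generators *)

Section splice.
Variable R : realType.
Local Notation F := (Fock R).
Local Notation bd := (bounded_operators F).
Local Notation cre := (@creation R).
Local Notation ann := (@annihilation R).
Local Notation vac := (vacuum R).
Implicit Types (N : nat) (k : int) (x y u w z : word) (s t : seq int) (T X : F -> F).

Definition low N : pred int := fun k => k < - N%:Z.

Definition middle N s := if s is a :: _ then - N%:Z <= a <= N%:Z else false.

(** Replaces the ending [y] of a word by [x], provided that all the letters in
    front of it are below [- N]. When both [x] and [y] start with a letter
    between [- N] and [N], increasing words are exchanged with increasing
    words, and generators with index outside that interval cannot tell the
    difference. *)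
Definition splice_fun N x y (w : word) : option word :=
  let t := take (size (val w) - size (val y)) (val w) in
  if suffix (val y) (val w) && all (low N) t then insub (t ++ val x) else None.

Lemma splice_funP N x y u w : splice_fun N x y u = Some w <->
  exists2 t, all (low N) t & val u = t ++ val y /\ val w = t ++ val x.
Proof.
rewrite /splice_fun; split=> [|[t tN [ut wt]]].
  case: ifP => // /andP[/suffixP[t ut]]; rewrite ut size_cat addnK take_size_cat//.
  by move=> tN; case: insubP => // z _ zt [<-]; exists t.
rewrite ut suffix_suffix size_cat addnK take_size_cat// tN /=.
by rewrite -wt valK.
Qed.

Lemma splice_inverse N x y :
  partial_inverse (splice_fun N x y) (splice_fun N y x).
Proof.
by move=> u w; split=> /splice_funP[t tN [h1 h2]]; apply/splice_funP; exists t.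
Qed.

Fact splice_inj N x y u w z : splice_fun N x y u = Some z ->
  splice_fun N x y w = Some z -> u = w.
Proof. by move=> /splice_inverse h /splice_inverse; rewrite h => -[]. Qed.

Definition splice N x y (f : F) : F := L2 (pullback_subproof f (@splice_inj N x y)).

Lemma splice_pulls N x y : pulls (splice N x y) (splice_fun N x y).
Proof. by []. Qed.

Lemma bd_splice N x y : bd (splice N x y).
Proof. exact: pulls_bd (@splice_inverse N x y) (@splice_pulls N x y). Qed.

Lemma adj_splice N x y : is_adjoint (splice N x y) (splice N y x).
Proof.
exact: pulls_adjoint (@splice_inverse N x y) (@splice_pulls N x y)
  (@splice_pulls N y x).
Qed.

Lemma sorted_low_cat N s t : all (low N) t -> middle N s -> sorted <%R s ->
  sorted <%R (t ++ s) = sorted <%R t.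
Proof.
case: s => // a s tN /andP[Na _] ss.
rewrite !lt_sorted_pairwise in ss *; rewrite pairwise_cat ss andbT.
rewrite (_ : allrel _ _ _ = true)//; apply/allrelP => i j it.
rewrite inE => /predU1P[->|js]; first by have := (allP tN) _ it; rewrite /low; lia.
have := (allP tN) _ it; move: ss => /= /andP[/allP h _]; have := h _ js.
by rewrite /low; lia.
Qed.

Lemma pulls_commute (S T : F -> F) (p q : word -> option word) :
  pulls S p -> pulls T q ->
  (forall u z, obind q (p u) = Some z <-> obind p (q u) = Some z) ->
  S \o T = T \o S.
Proof.
move=> Sp Tq pq; apply/funext => f; apply: l2_ext => u /=; rewrite Sp Tq.
transitivity (oapp f 0 (obind q (p u))).
  by case: (p u) => //= z; rewrite Tq.
transitivity (oapp f 0 (obind p (q u))); last first.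
  by case: (q u) => //= z; rewrite Sp.
have := pq u; case: (obind q (p u)) => [z|] h.
  by rewrite (proj1 (h z)).
case E : (obind p (q u)) => [z|//].
by have := proj2 (h z) E.
Qed.

(** If [k] is less than [- N], it joins the prefix in front of [x] or [y]. If
    [k] is greater than [N], it can precede neither ending, and both sides
    vanish on the words concerned. *)
Lemma splice_ann N x y k : middle N (val x) -> middle N (val y) ->
  ~~ (- N%:Z <= k <= N%:Z) ->
  splice N x y \o ann k = ann k \o splice N x y.
Proof.
move=> mx my kN; apply: pulls_commute (@splice_pulls N x y) (@ann_pulls R k) _.
move=> u z; split.
  case E : (splice_fun N x y u) => [w|//] /= /pushP zw.
  have /splice_funP[t tN [ut wt]] := E.
  have kt : k < - N%:Z.
    have : path <%R k (t ++ val x) by have := valP z; rewrite zw wt.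
    case: (t) tN => [|a t'].
      by rewrite cat0s; case: (val x) mx => //= b s mb _ /andP[kb _]; lia.
    rewrite cat_cons /=; move=> /andP[aN _] /andP[ka _]; rewrite /low in aN; lia.
  have ks : all (low N) (k :: t) by rewrite /= tN andbT.
  have sku : sorted <%R (k :: val u).
    rewrite ut -cat_cons (sorted_low_cat ks my (valP y)).
    rewrite -(sorted_low_cat ks mx (valP x)) cat_cons -wt -zw; exact: valP z.
  have -> : push k u = Some (exist (fun s => sorted <%R s) (k :: val u) sku).
    exact/pushP.
  have kut : k :: val u = (k :: t) ++ val y by rewrite ut.
  apply/splice_funP; exists (k :: t) => //; split; last by rewrite zw wt.
  exact: kut.
case E : (push k u) => [w|//] /= /splice_funP[t tN [wt zt]].
have /pushP wu := E; case: t tN wt zt => [|a t] tN wt zt.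
  by move: my; rewrite -[val y]/([::] ++ val y) -wt wu /= (negbTE kN).
move: wt; rewrite wu => -[ka ut]; rewrite -{a}ka in tN zt.
have sz : sorted <%R (t ++ val x).
  by apply: (@path_sorted _ _ k); have := valP z; rewrite zt.
have -> : splice_fun N x y u = Some (exist (fun s => sorted <%R s) (t ++ val x) sz).
  by apply/splice_funP; exists t => //; case/andP: tN.
by apply/pushP.
Qed.

(** By passing to adjoints in [splice_ann], as the adjoint of a splice is the
    inverse splice. *)
Lemma splice_cre N x y k : middle N (val x) -> middle N (val y) ->
  ~~ (- N%:Z <= k <= N%:Z) ->
  splice N x y \o cre k = cre k \o splice N x y.
Proof.
move=> mx my kN.
have h1 := adjoint_comp (adj_ann k) (adj_splice N y x).
have h2 := adjoint_comp (adj_splice N y x) (adj_ann k).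
by apply: adjoint_unique h1 _; rewrite -splice_ann.
Qed.

Lemma exists_middle s : exists N, all (fun a => - N%:Z <= a <= N%:Z) s.
Proof.
elim: s => [|a s [N HN]]; first by exists 0.
exists (maxn N `|a|%N) => /=; apply/andP; split; first by lia.
by apply: sub_all HN => b; lia.
Qed.

Lemma splice_l2e N x y : splice N x y (l2e R x) = l2e R y.
Proof.
rewrite (pulls_l2e x (@splice_inverse N x y) (@splice_pulls N x y)).
by rewrite (proj2 (@splice_funP N y x x y)) //; exists [::].
Qed.

Lemma splice_vac N x y : middle N (val x) -> splice N x y vac = 0.
Proof.
move=> mx.
rewrite (pulls_l2e empty_word (@splice_inverse N x y) (@splice_pulls N x y)).
case E : (splice_fun N y x empty_word) => [w|//].
have /splice_funP[t _ [/(congr1 size)/eqP + _]] := E.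
by rewrite size_cat eq_sym addn_eq0 => /andP[_ /nilP x0]; rewrite x0 in mx.
Qed.

(** As [N] grows, the splice of [x] with itself shrinks to the projection onto
    the line of the basis vector of [x], so these vectors are eigenvectors;
    splicing [x] with [y] compares the eigenvalues of nonempty words. *)
Lemma splice_commutant X : bd X ->
  (forall N x y, middle N (val x) -> middle N (val y) ->
    X \o splice N x y = splice N x y \o X) ->
  vacuum_diagonal X.
Proof.
move=> bX XS.
have XSv N x y v : middle N (val x) -> middle N (val y) ->
    X (splice N x y v) = splice N x y (X v).
  by move=> mx my; have := congr1 (@^~ v) (XS _ _ _ mx my).
have mid x : val x != [::] -> exists N, middle N (val x).
  have [N] := exists_middle (val x); case: (val x) => // a s /andP[aN _] _.
  by exists N.
have Xe x : val x != [::] -> X (l2e R x) = (X (l2e R x) : l2 R word) x *: l2e R x.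
  move=> x0; apply: l2_ext => w.
  change ((X (l2e R x) : l2 R word) w = (X (l2e R x) : l2 R word) x * (w == x)%:R).
  have [->|wx] := eqVneq; first by rewrite mulr1.
  (* For [N] as large as the letters of [w] and [x], the only word ending with
     [x] behind letters below [- N] that can be [w] is [x] itself. *)
  have [N] := exists_middle (val w ++ val x); rewrite all_cat => /andP[Nw Nx].
  have mx : middle N (val x) by case: (val x) x0 Nx => //= a s _ /andP[].
  rewrite mulr0 -{1}(splice_l2e N x x) XSv// splice_pulls.
  case E : (splice_fun N x x w) => [z|//]; exfalso.
  have /splice_funP[t tN [wt _]] := E; case: t tN wt => [|a t] tN wt.
    by move/eqP: wx; apply; apply/val_inj; rewrite wt.
  by move: Nw tN; rewrite wt /low /= => /andP[h _] /andP[h' _]; lia.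
(* Any nonempty word serves as the reference for the common eigenvalue. *)
pose mu := (X (l2e R (letter 0)) : l2 R word) (letter 0).
have Xmu x : val x != [::] -> X (l2e R x) = mu *: l2e R x.
  move=> x0; have [N mx] := mid x x0.
  have ml : middle N (val (letter 0)) by rewrite /=; lia.
  rewrite -(splice_l2e N (letter 0) x) XSv// (Xe (letter 0))//.
  by rewrite (linZ (bd_lin (bd_splice N _ _))).
exists (ev (X vac) [::]), mu.
apply/funext; apply: bd_eq_l2e.
- exact: bd_lin bX.
- exact: bd_lin (bdD _ (bd_P R) (bdZ mu (bdB (@bd_id _ _) (bd_P R)))).
- exact: bd_bound bX.
- exact: bd_bound (bdD _ (bd_P R) (bdZ mu (bdB (@bd_id _ _) (bd_P R)))).
move=> w; have [w0|w0] := eqVneq (val w) [::]; last first.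
  rewrite Xmu// /vacuum_projection hdot_l2e.
  have -> : (l2e R w : l2 R word) empty_word = 0.
    by rewrite /=; case: eqP => // h; rewrite -h in w0.
  by rewrite scale0r scaler0 add0r subr0.
have -> : w = empty_word by apply/val_inj.
have Pv : vacuum_projection vac = vac.
  by rewrite /vacuum_projection hdot_vac ev_vac eqxx scale1r.
rewrite -[l2e R _]/vac Pv subrr scaler0 addr0.
apply: ev_ext => s ss; rewrite evZ ev_vac.
have [->|s0] := eqVneq s [::]; first by rewrite mulr1.
pose z : word := exist _ s ss; have [N mz] := mid z s0.
rewrite mulr0 (evE _ z).
have := XSv N z z vac mz mz; rewrite splice_vac// (lin0 (bd_lin bX)).
move=> /(congr1 (fun f : l2 R word => f z)); rewrite splice_pulls.
by rewrite (proj2 (@splice_funP N z z z z)) //; exists [::].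
Qed.

End splice.

(** * Tail algebras *)

Section tails.
Variables (R : realType) (H : hilbertType R) (pi : (Fock R -> Fock R) -> H -> H).
Local Notation bd := (bounded_operators H).
Implicit Types (S T X Y : H -> H) (I : set int).

Lemma commutant_lin (G : set (H -> H)) c X Y : G `<=` bd ->
  commutant G X -> commutant G Y -> commutant G (fun v => c *: X v + Y v).
Proof.
move=> Gb [bX hX] [bY hY]; split=> [|T GT]; first exact: bdD.
apply/funext => v /=; rewrite (bd_lin (Gb _ GT)).
have := congr1 (@^~ v) (hX _ GT); have := congr1 (@^~ v) (hY _ GT) => /= -> ->.
by [].
Qed.

Lemma tail_lin c X Y : tail_algebra pi X -> tail_algebra pi Y ->
  tail_algebra pi (fun v => c *: X v + Y v).
Proof.
by move=> tX tY I fI; apply: commutant_lin (tX I fI) (tY I fI) => T [].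
Qed.

(** By [vN_generated_commute], [G] lies in the commutant of every finite block
    of samples with indices outside [I]. *)
Lemma tail_commute (G : set (H -> H)) I T : finite_set I -> G `<=` bd ->
  (forall S, G S -> exists2 S', G S' & is_adjoint S S') ->
  (forall S k x, G S -> ~ I k -> bd (process pi k x) /\
    S \o process pi k x = process pi k x \o S) ->
  tail_algebra pi T -> bd T /\ forall S, G S -> T \o S = S \o T.
Proof.
move=> fI Gb Gs Gc /(_ I fI)[bT hT]; split=> // S GS; apply: hT.
split=> [|X [K [fK KI] vX]]; first exact: Gb.
have [|_ h] := @vN_generated_commute _ _ G
  (\bigcup_(k in K) range (process pi k)) Gb Gs _ S GS; last exact: h.
move=> S' X' GS' [k Kk [x _ <-]]; apply: Gc => // Ik.
by have : (K `&` I) k by []; rewrite KI.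
Qed.

Lemma tail_intro T : bd T ->
  (forall I S, finite_set I -> bd S ->
    (forall k x, ~ I k -> S \o process pi k x = process pi k x \o S) ->
    S \o T = T \o S) ->
  tail_algebra pi T.
Proof.
move=> bT h I fI; split=> // S [bS hS]; symmetry; apply: (h I) => // k x nIk.
apply: hS; exists [set k].
  by split; [exact: finite_set1|apply/seteqP; split=> // i [/= -> //]].
by apply: vN_generated_sub; exists k => //; exists x.
Qed.

Lemma tail_id : tail_algebra pi idfun.
Proof. by apply: tail_intro => //; exact: bd_id. Qed.

(** Operators that commute with almost all samples commute with a tail of the
    sequence, hence with its limit. *)
Lemma tail_limit T (k_ : nat -> int) x : bd T -> (forall n, `|k_ n|%N = n) ->
  (forall v, hconverges hdot (fun n => process pi (k_ n) x v) (T v)) ->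
  tail_algebra pi T.
Proof.
move=> bT kn cT; apply: tail_intro => // I S /finite_seqP[s Is] bS Sk.
have [N HN] := exists_middle s.
apply: (@commute_strong_limit _ _ S T (fun n => process pi (k_ n) x)) => //.
exists N.+1 => n nN; apply: Sk; rewrite Is /= => sk.
by have := (allP HN) _ sk; have := kn n; lia.
Qed.

End tails.

Section representations.
Variable R : realType.
Local Notation F := (Fock R).
Local Notation C := (Cline R).
Local Notation FC := (hsum F C).
Local Notation bdF := (bounded_operators F).
Local Notation bdFC := (bounded_operators FC).
Local Notation cre := (@creation R).
Local Notation ann := (@annihilation R).
Local Notation opw := (@operator_word R).
Local Notation M := (@monotone_algebra R).
Local Notation P := (@vacuum_projection R).
Local Notation vac := (vacuum R).
Local Notation state := (@state_at_infinity R).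

Lemma Cline_bd : bounded_operators C = scalar_operators C.
Proof.
apply/seteqP; split=> [T bT|_ [c ->]]; last exact: bd_scalar.
exists (T (1 : R[i])); apply/funext => z.
have := linZ (bd_lin bT) (z : R[i]) (1 : R[i]).
have -> : (z : R[i]) *: (1 : C) = z by exact: mulr1.
by move=> ->; exact: mulrC.
Qed.

Lemma bicommutant_Cline (G : set (C -> C)) : bicommutant G = scalar_operators C.
Proof.
rewrite -Cline_bd; apply/seteqP; split=> [T []//|T bT]; split=> // S [+ _].
rewrite Cline_bd => -[c ->]; apply/funext => v /=; exact: linZ (bd_lin bT) _ _.
Qed.

Lemma finite_middle (N : nat) : finite_set [set k : int | - N%:Z <= k <= N%:Z].
Proof.
apply: sub_finite_set (finite_seq [seq i%:Z - N%:Z | i <- iota 0 (N + N).+1]).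
move=> k /= kN.
have : k \in [seq i%:Z - N%:Z | i <- iota 0 (N + N).+1]; last by [].
by apply/mapP; exists `|(k + N%:Z)%R|%N; [rewrite mem_iota|]; lia.
Qed.

(** * Cyclicity of the vacuum *)

Lemma M_cyclic (v : F) (e : R) : 0 < e -> exists2 X, M X & hn (v - X vac) < e.
Proof.
move=> e0; have [s [_ hs]] := l2_dense v e0.
exists (fun u => \sum_(w <- s) v w *: opw (map cre (val w)) u).
  elim: s {hs} => [|w s IH].
    by have h := @M0 R; apply: (mem_eqfun _ h) => u; rewrite big_nil.
  have h := M_lin (v w) (M_opw_cre (val w)) IH.
  by apply: (mem_eqfun _ h) => u; rewrite big_cons.
by under eq_bigr do rewrite cre_word_vac.
Qed.

(** The projection [above 0] fixes the vacuum and has value zero at infinity,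
    so multiples of its complement adjust the state without moving the image
    of the vacuum. *)
Lemma M_cyclic_state (v : F) (z : R[i]) (e : R) : 0 < e ->
  exists X, [/\ M X, hn (v - X vac) < e & state X = z].
Proof.
move=> e0; have [X MX Xe] := M_cyclic v e0.
have MI := M_lin (-1) (M_above 0) (@M_id R).
exists (fun u => (z - state X) *: (-1 *: above 0 u + u) + X u); split.
- exact: M_lin MI MX.
- by rewrite above_vac scaleN1r addNr scaler0 add0r.
- rewrite (state_lin _ MI MX) (state_lin _ (M_above 0) (@M_id R)).
  by rewrite state_above mulr0 add0r state_id mulr1 subrK.
Qed.

(** * The vacuum representation *)

Lemma bicommutant_vacuum : bicommutant (@rep_vacuum R @` M) = bdF.
Proof.
apply/seteqP; split=> [T []//|T bT]; split=> // S [bS hS].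
have MS X : M X -> S \o X = X \o S by move=> MX; apply: hS; exists X.
have [c ->] := commutant_scalar bS (fun i => MS _ (M_ann i))
  (fun i => MS _ (M_cre i)).
by apply/funext => v /=; rewrite (linZ (bd_lin bT)).
Qed.

Lemma diagonalE (lambda mu : R[i]) :
  (fun v => lambda *: P v + mu *: (v - P v)) =
  (fun v => (lambda - mu) *: P v + (mu *: idfun v + 0)).
Proof.
apply/funext => v /=; rewrite addr0 scalerBl scalerBr addrA.
by rewrite [RHS]addrAC.
Qed.

(** One inclusion is [splice_commutant]; for the other the vacuum projection is
    the strong limit of the samples [above n], as [n] tends to infinity. *)
Lemma tail_vacuum : tail_algebra (@rep_vacuum R) = @vacuum_diagonal R.
Proof.
apply/seteqP; split=> [T tT|_ [l [mu ->]]].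
  have [bT _] := tT set0 (finite_set0 _).
  apply: splice_commutant => // N x y mx my.
  have [|||_ h] := @tail_commute R F (@rep_vacuum R)
    [set S | exists x y, [/\ middle N (val x), middle N (val y) & S = splice N x y]]
    [set k | - N%:Z <= k <= N%:Z] T (finite_middle N) _ _ _ tT.
  - by move=> _ [x' [y' [_ _ ->]]]; exact: bd_splice.
  - move=> _ [x' [y' [mx' my' ->]]]; exists (splice N y' x'); last exact: adj_splice.
    by exists y', x'.
  - move=> _ k X [x' [y' [mx' my' ->]]] /negP kN; rewrite processE.
    split; first exact: M_bd (M_sample k X).
    apply: sample_commute; [exact: bd_lin (bd_splice _ N x' y')|exact: splice_ann|].
    exact: splice_cre.
  - by apply: h; exists x, y.
have tP : tail_algebra (@rep_vacuum R) P.
  apply: (@tail_limit _ _ _ P (fun n => n%:Z) (delta_mx 0 0, 0)) => //.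
    exact: bd_P.
  by move=> v; under eq_fun do rewrite processE sample_above; exact: above_cvg.
have t0 := tail_lin mu (tail_id (@rep_vacuum R))
  (tail_lin (-1) (tail_id (@rep_vacuum R)) (tail_id (@rep_vacuum R))).
rewrite diagonalE; apply: mem_eqfun (tail_lin (l - mu) tP t0) => v.
by rewrite scaleN1r addNr.
Qed.

Lemma GNS_vacuum : is_GNS_triple M (symmetric_state 1) (@rep_vacuum R) vac.
Proof.
split=> //; first exact: M_bd.
- by move=> X MX; rewrite /symmetric_state subrr mul0r addr0 mul1r.
- by move=> v e e0; have [X MX Xe] := M_cyclic v e0; exists X.
Qed.

(** * The representation at infinity *)

Lemma GNS_infinity :
  is_GNS_triple M (symmetric_state 0) (@rep_infinity R) (1 : R[i]^o).
Proof.
split.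
- by move=> X _; exact: bd_scalar.
- by rewrite /rep_infinity state_id; apply/funext => z; rewrite scale1r.
- move=> c X Y MX MY; rewrite /rep_infinity state_lin//; apply/funext => z.
  by rewrite scalerDl scalerA.
- move=> X Y MX MY; rewrite /rep_infinity state_comp//; apply/funext => z /=.
  by rewrite scalerA.
- move=> X Y MX MY XY; rewrite /rep_infinity (state_adjoint MX MY XY).
  exact: adjoint_scalar.
- move=> X MX; rewrite /rep_infinity /symmetric_state subr0 mul0r add0r mul1r.
  rewrite hdotZl.
  have -> : hdot (1 : C) (1 : C) = 1.
    by change ((1 : R[i]) * Num.conj 1 = 1); rewrite mul1r rmorph1.
  by rewrite mulr1.
- move=> v e e0; exists (fun u => (v : R[i]) *: u); first exact: MZ (@M_id R).
  rewrite /rep_infinity state_scalar.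
  have -> : (v : R[i]) *: (1 : C) = v by exact: mulr1.
  by rewrite subrr hn0.
Qed.

Lemma tail_infinity : tail_algebra (@rep_infinity R) = scalar_operators C.
Proof.
apply/seteqP; split=> [T /(_ set0 (finite_set0 _))|T sT I _].
  by rewrite bicommutant_Cline.
by rewrite bicommutant_Cline.
Qed.

End representations.

(** * Direct sums of Hilbert spaces *)

Section direct_sums.
Variables (R : realType) (H1 H2 : hilbertType R).
Local Notation H := (hsum H1 H2).
Local Notation bd := (bounded_operators H).
Implicit Types (x y : H).

Lemma hdot_pair x y : hdot x y = hdot x.1 y.1 + hdot x.2 y.2. Proof. by []. Qed.

Lemma hn_pair x : hn x = Num.sqrt (hn x.1 ^+ 2 + hn x.2 ^+ 2).
Proof. exact: hnorm_sumE. Qed.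

Lemma hn_fst x : hn x.1 <= hn x.
Proof.
rewrite hn_pair -[leLHS]ger0_norm ?hn_ge0// -sqrtr_sqr.
by rewrite ler_sqrt ?addr_ge0 ?sqr_ge0// lerDl sqr_ge0.
Qed.

Lemma hn_snd x : hn x.2 <= hn x.
Proof.
rewrite hn_pair -[leLHS]ger0_norm ?hn_ge0// -sqrtr_sqr.
by rewrite ler_sqrt ?addr_ge0 ?sqr_ge0// lerDr sqr_ge0.
Qed.

Lemma hn_pair0r (u : H1) : hn ((u, 0) : H) = hn u.
Proof. by rewrite hn_pair /= hn0 expr0n addr0 sqrtr_sqr ger0_norm// hn_ge0. Qed.

Lemma hn_pair0l (u : H2) : hn ((0, u) : H) = hn u.
Proof. by rewrite hn_pair /= hn0 expr0n add0r sqrtr_sqr ger0_norm// hn_ge0. Qed.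

Lemma pair_split x : x = (x.1, 0) + (0, x.2) :> H.
Proof. by case: x => u v; congr pair; rewrite /= ?addr0 ?add0r. Qed.

Lemma hn_pair_le x : hn x <= hn x.1 + hn x.2.
Proof.
rewrite {1}(pair_split x); apply: le_trans (ler_hnD _ _) _.
by rewrite hn_pair0r hn_pair0l.
Qed.

Lemma bd_opsum (A : H1 -> H1) (B : H2 -> H2) : bounded_operators H1 A ->
  bounded_operators H2 B -> bd (opsum A B).
Proof.
move=> bA bB; have [M M0 AM] := bd_bound bA; have [N N0 BN] := bd_bound bB.
split=> [c x y|].
  by congr pair; [exact: (bd_lin bA)|exact: (bd_lin bB)].
exists (M + N) => x; apply: le_trans (hn_pair_le _) _; rewrite mulrDl.
apply: lerD => /=.
  by apply: le_trans (AM _) _; rewrite ler_wpM2l// hn_fst.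
by apply: le_trans (BN _) _; rewrite ler_wpM2l// hn_snd.
Qed.

Lemma adj_opsum (A A' : H1 -> H1) (B B' : H2 -> H2) : is_adjoint A A' ->
  is_adjoint B B' -> is_adjoint (opsum A B) (opsum A' B').
Proof. by move=> aA aB x y; rewrite !hdot_pair /= aA aB. Qed.

Definition proj_fst : H -> H := opsum idfun (fun=> 0).

Lemma bd_proj_fst : bd proj_fst.
Proof. exact: bd_opsum (@bd_id _ _) (@bd0 _ _). Qed.

Lemma adj_zero (K : hilbertType R) : is_adjoint (fun=> 0 : K) (fun=> 0).
Proof. by move=> u v; rewrite hdot0l hdot0r. Qed.

Lemma opsum_proj_fst (A : H1 -> H1) (B : H2 -> H2) : B 0 = 0 ->
  proj_fst \o opsum A B = opsum A B \o proj_fst.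
Proof. by move=> B0; apply/funext => x; congr pair; rewrite /= B0. Qed.

(** The off-diagonal blocks of [T] are the two ways in which it could fail to
    commute with the projection. *)
Lemma proj_fst_commute (T : H -> H) : bd T -> T \o proj_fst = proj_fst \o T ->
  exists A B, [/\ bounded_operators H1 A, bounded_operators H2 B & T = opsum A B].
Proof.
move=> bT Tp; have lT := bd_lin bT; have [M M0 TM] := bd_bound bT.
exists (fun u => (T (u, 0)).1), (fun u => (T (0, u)).2); split.
- split=> [c u v|].
    have -> : (c *: u + v, 0) = c *: ((u, 0) : H) + (v, 0).
      by congr pair; rewrite /= scaler0 addr0.
    by rewrite lT.
  by exists M => u; apply: le_trans (hn_fst _) _; rewrite -(hn_pair0r u).
- split=> [c u v|].
    have -> : (0, c *: u + v) = c *: ((0, u) : H) + (0, v).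
      by congr pair; rewrite /= scaler0 addr0.
    by rewrite lT.
  by exists M => u; apply: le_trans (hn_snd _) _; rewrite -(hn_pair0l u).
apply/funext => x; rewrite {1}(pair_split x) (linD lT).
have h1 := congr1 (@^~ ((x.1, 0) : H)) Tp.
have h2 := congr1 (@^~ ((0, x.2) : H)) Tp.
have /= {}h1 : T (x.1, 0) = ((T (x.1, 0)).1, 0) by exact: h1.
have {}h2 : (0, 0) = ((T (0, x.2)).1, 0) :> H.
  by rewrite -[LHS](lin0 lT); exact: h2.
rewrite h1; congr pair; rewrite /= ?add0r//.
by move: h2 => /(congr1 fst) /= <-; rewrite addr0.
Qed.

End direct_sums.

(** * The mixed representation *)

Section mixed.
Variable R : realType.
Local Notation F := (Fock R).
Local Notation C := (Cline R).
Local Notation FC := (hsum F C).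
Local Notation bdF := (bounded_operators F).
Local Notation bdFC := (bounded_operators FC).
Local Notation cre := (@creation R).
Local Notation ann := (@annihilation R).
Local Notation opw := (@operator_word R).
Local Notation M := (@monotone_algebra R).
Local Notation P := (@vacuum_projection R).
Local Notation vac := (vacuum R).
Local Notation state := (@state_at_infinity R).
Local Notation rep := (@rep_mixed R).
Implicit Types (S T : FC -> FC) (c l m : R[i]).

Definition mult (c : R[i]) : C -> C := fun z => c *: z.

Lemma bd_mult c : bounded_operators C (mult c). Proof. exact: bd_scalar. Qed.

Lemma repE Y : rep Y = opsum Y (mult (state Y)). Proof. by []. Qed.

Lemma rep_sample k x : process rep k x = opsum (sample k x) (mult x.2).
Proof. by rewrite processE repE state_sample. Qed.

Lemma bd_rep Y : M Y -> bdFC (rep Y).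
Proof. by move=> MY; rewrite repE; exact: bd_opsum (M_bd MY) (bd_mult _). Qed.

(** The off-diagonal blocks of an element of the commutant intertwine the
    identity representation with the state at infinity. One of them gives a
    vector killed by the generators, the other a functional that vanishes on
    the ranges of all creation operators and, through [above 0], at the
    vacuum; so both are zero. *)
Lemma commutant_mixed S : commutant (rep @` M) S ->
  exists l m, S = opsum (fun v => l *: v) (mult m).
Proof.
move=> [bS hS]; have lS := bd_lin bS; have [N N0 SN] := bd_bound bS.
have SM X x : M X -> S (X x.1, state X *: x.2) = (X (S x).1, state X *: (S x).2).
  by move=> MX; have := congr1 (@^~ x) (hS _ (ex_intro2 _ _ X MX erefl)).
have S12 z : (S (0, z)).1 = 0.
  set u := (S (0, z)).1.
  have kill X : M X -> linear X -> state X = 0 -> X u = 0.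
    move=> MX lX X0; have := SM X (0, z) MX.
    by rewrite X0 !scale0r (lin0 lX) (lin0 lS) => /(congr1 fst) /= <-.
  have au i : ann i u = 0.
    exact: (kill (ann i) (M_ann i) (bd_lin (bd_ann i)) (state_ann _ i)).
  have cu : cre 0 u = 0.
    exact: (kill (cre 0) (M_cre 0) (bd_lin (bd_cre 0)) (state_cre _ 0)).
  have u0 : ev (cre 0 u) [:: 0] = 0 by rewrite cu ev0.
  rewrite ev_cre_cons eqxx /= in u0.
  by rewrite (ann_all0 au) u0 scale0r.
have S21 v : (S (v, 0)).2 = 0.
  have kill X w : M X -> state X = 0 -> (S (X w, 0)).2 = 0.
    move=> MX X0; have := SM X (w, 0) MX.
    by rewrite X0 scale0r => ->; rewrite /= scale0r.
  apply: (@bd_eq_l2e R word C (fun v => (S (v, 0)).2) (fun=> 0)).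
  - move=> c u w.
    have -> : (c *: u + w, 0) = c *: ((u, 0) : FC) + (w, 0).
      by congr pair; rewrite /= scaler0 addr0.
    by rewrite lS.
  - by move=> c u w; rewrite scaler0 add0r.
  - by exists N => // u; apply: le_trans (hn_snd _) _; rewrite -(@hn_pair0r _ F C u).
  - by exists 0 => // u; rewrite hn0 mul0r.
  - move=> w; rewrite -cre_word_vac; case: (val w) => [|i s] /=.
      rewrite -(above_vac R 0).
      exact: (kill (above 0) vac (M_above 0) (state_above _ 0)).
    exact: (kill (cre i) _ (M_cre i) (state_cre _ i)).
have Sp : S \o @proj_fst R F C = @proj_fst R F C \o S.
  apply/funext => x; change (S (x.1, 0) = ((S x).1, 0)).
  have -> : (S x).1 = (S (x.1, 0)).1.
    by rewrite {1}(pair_split x) (linD lS) /= S12 addr0.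
  by rewrite [LHS]surjective_pairing S21.
have [A [B [bA bB SE]]] := proj_fst_commute bS Sp.
have /= AM X v : M X -> A (X v) = X (A v).
  by move=> MX; have := SM X (v, 0) MX; rewrite SE => /(congr1 fst).
have [||l Al] := commutant_scalar bA.
- by move=> i; apply/funext => v; exact: AM (M_ann i).
- by move=> i; apply/funext => v; exact: AM (M_cre i).
have [m Bm] : scalar_operators C B by rewrite -Cline_bd.
by exists l, m; rewrite SE Al Bm.
Qed.

Lemma proj_fst_commutant : commutant (rep @` M) (@proj_fst R F C).
Proof.
split; first exact: bd_proj_fst.
by move=> _ [X MX <-]; rewrite repE; apply: opsum_proj_fst; rewrite /mult scaler0.
Qed.

Lemma bicommutant_mixed :
  bicommutant (rep @` M) = opsum_set bdF (scalar_operators C).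
Proof.
apply/seteqP; split=> [T [bT hT]|_ [A bA [_ [c ->] <-]]].
  have [A [B [bA bB ->]]] := proj_fst_commute bT (hT _ proj_fst_commutant).
  by exists A => //; exists B => //; rewrite -Cline_bd.
split=> [|S /commutant_mixed[l [m ->]]]; first exact: bd_opsum (bd_mult c).
apply/funext => x; congr pair; first by rewrite /= (linZ (bd_lin bA)).
by rewrite /= /mult !scalerA mulrC.
Qed.

(** Operators on the direct sum that commute with all samples of index outside
    the interval from [- N] to [N]: splices of the first summand, and the
    projection onto it. *)
Definition splices_mixed (N : nat) : set (FC -> FC) :=
  [set @proj_fst R F C] `|` [set S | exists x y,
    [/\ middle N (val x), middle N (val y) & S = opsum (splice N x y) (fun=> 0)]].

Lemma tail_mixed_diagonal T : tail_algebra rep T ->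
  opsum_set (@vacuum_diagonal R) (scalar_operators C) T.
Proof.
move=> tT.
have h N : bdFC T /\ forall S, splices_mixed N S -> T \o S = S \o T.
  apply: (tail_commute (finite_middle N) _ _ _ tT).
  - move=> _ [->|[x [y [_ _ ->]]]]; first exact: bd_proj_fst.
    exact: bd_opsum (bd_splice R N x y) (@bd0 _ _).
  - move=> _ [->|[x [y [mx my ->]]]].
      exists (@proj_fst R F C); first by left.
      by apply: adj_opsum => //; exact: adj_zero.
    exists (opsum (splice N y x) (fun=> 0)); first by right; exists y, x.
    by apply: adj_opsum; [exact: adj_splice|exact: adj_zero].
  - move=> S k x NS /negP kN; rewrite rep_sample; split.
      exact: bd_opsum (M_bd (M_sample k x)) (bd_mult _).
    case: NS => [->|[z [y [mz my ->]]]].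
      by apply: opsum_proj_fst; rewrite /mult scaler0.
    apply/funext => v; congr pair; last by rewrite /= /mult scaler0.
    have /= := congr1 (@^~ v.1) (sample_commute x (bd_lin (bd_splice R N z y))
      (splice_ann R mz my kN) (splice_cre R mz my kN)).
    by [].
have [bT h0] := h 0.
have [A [B [bA bB TE]]] := proj_fst_commute bT (h0 _ (or_introl erefl)).
exists A; last by exists B; rewrite -?Cline_bd.
apply: splice_commutant => // N x y mx my; apply/funext => v.
have [_ hN] := h N.
have := hN (opsum (splice N x y) (fun=> 0)); rewrite TE => /(_ _).
move=> /(_ (or_intror (ex_intro _ x (ex_intro _ y (And3 mx my erefl))))).
by move=> /(congr1 (@^~ ((v, 0) : FC))) /(congr1 fst).
Qed.

Lemma hconverges_fst (s : nat -> F) v (z : C) : hconverges hdot s v ->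
  hconverges hdot (fun n => (s n, z) : FC) (v, z).
Proof.
move=> /hconvergesP h; apply/hconvergesP => e /h[N HN]; exists N => n /HN.
have -> : ((s n, z) : FC) - (v, z) = (s n - v, 0) by congr pair; rewrite /= subrr.
by rewrite hn_pair0r.
Qed.

(** Besides the vacuum projection, the tail algebra contains the projection onto
    the second summand: it is the limit, as the index tends to minus infinity,
    of the samples of the unit of the second summand of the sample algebra,
    for which [sum_below] tends to zero while the state at infinity stays equal
    to 1. *)
Lemma tail_mixed :
  tail_algebra rep = opsum_set (@vacuum_diagonal R) (scalar_operators C).
Proof.
apply/seteqP; split=> [T|_ [_ [l [mu ->]] [_ [c ->] <-]]].
  exact: tail_mixed_diagonal.
have tP : tail_algebra rep (opsum P (fun=> 0)).
  apply: (@tail_limit _ _ _ _ (fun n => n%:Z) (delta_mx 0 0, 0)) => // [|v].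
    exact: bd_opsum (bd_P R) (@bd0 _ _).
  under eq_fun do rewrite rep_sample sample_above.
  rewrite /opsum /mult /= scale0r; apply: hconverges_fst; exact: above_cvg.
have t2 : tail_algebra rep (opsum (fun=> 0) (mult 1)).
  apply: (@tail_limit _ _ _ _ (fun n => - n%:Z) (0, 1)) => // [|n|v].
  - exact: bd_opsum (@bd0 _ _) (bd_mult _).
  - by rewrite abszN.
  under eq_fun do rewrite rep_sample sample_sum_below.
  by rewrite /opsum /=; apply: hconverges_fst; exact: sum_below_cvg.
have t0 : tail_algebra rep (fun=> 0).
  have h := tail_lin (-1) (tail_id rep) (tail_id rep).
  by apply: mem_eqfun h => v; rewrite scaleN1r addNr.
have h := tail_lin (l - mu) tP (tail_lin mu (tail_id rep) (tail_lin (c - mu) t2 t0)).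
apply: mem_eqfun h => v; congr pair => /=.
  have := congr1 (@^~ v.1) (diagonalE l mu) => /= ->.
  by rewrite scaler0 !addr0.
by rewrite scaler0 add0r /mult addr0 scale1r -scalerDl addrC subrK.
Qed.

Lemma conjcR (a : R) : Num.conj a%:C%C = a%:C%C.
Proof. by apply/eqP; rewrite eq_complex /= oppr0 !eqxx. Qed.

Lemma GNS_mixed (gamma : R) : 0 < gamma < 1 ->
  is_GNS_triple M (symmetric_state gamma) rep (vector_mixed gamma).
Proof.
move=> /andP[g0 g1]; split.
- exact: bd_rep.
- by rewrite repE state_id; apply/funext => -[u z]; rewrite /opsum /mult /= scale1r.
- move=> c X Y MX MY; rewrite !repE state_lin//; apply/funext => x.
  by congr pair; rewrite /= /mult scalerDl scalerA.
- move=> X Y MX MY; rewrite !repE state_comp//; apply/funext => x.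
  by congr pair; rewrite /= /mult scalerA.
- move=> X Y MX MY XY; rewrite !repE (state_adjoint MX MY XY).
  by apply: adj_opsum XY _; exact: adjoint_scalar.
- move=> X MX; have lX := bd_lin (M_bd MX).
  rewrite repE hdot_pair /vector_mixed /= /mult (linZ lX) !hdotZl hdotZr conjcR.
  rewrite /symmetric_state /vacuum_state mulrA; congr (_ * _ + _).
    by rewrite -rmorphM -expr2 sqr_sqrtr// ltW.
  rewrite mulrC; congr (_ * _).
  change ((Num.sqrt (1 - gamma))%:C%C * Num.conj (Num.sqrt (1 - gamma))%:C%C =
    (1 - gamma)%:C%C).
  by rewrite conjcR -rmorphM -expr2 sqr_sqrtr// subr_ge0 ltW.
- move=> [v z] e e0; pose a := (Num.sqrt gamma)%:C%C : R[i].
  pose b := (Num.sqrt (1 - gamma))%:C%C : R[i].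
  have a0 : a != 0 by rewrite eq_complex /= eqxx andbT gt_eqF// sqrtr_gt0.
  have b0 : b != 0 by rewrite eq_complex /= eqxx andbT gt_eqF// sqrtr_gt0 subr_gt0.
  have [d0 dc] := eps_div (normc_ge0 a) e0.
  have [X [MX Xv Xz]] := M_cyclic_state (a^-1 *: v) ((z : R[i]) / b) d0.
  exists X => //.
  have -> : ((v, z) : FC) - rep X (vector_mixed gamma) =
      (a *: (a^-1 *: v - X vac), 0).
    congr pair; rewrite /=.
      rewrite /rep_vacuum (linZ (bd_lin (M_bd MX))) scalerBr scalerA divff//.
      by rewrite scale1r.
    rewrite /rep_infinity Xz.
    change ((z : R[i]) - z / b * b = 0); by rewrite divfK// subrr.
  rewrite hn_pair0r hnZ; apply: le_lt_trans dc.
  by rewrite ler_wpM2l ?normc_ge0// ltW.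
Qed.

End mixed.

Theorem proposition3p4 (R : realType) (gamma : R) (gamma01 : 0 <= gamma <= 1) :
  let M := @monotone_algebra R in
  let phi := symmetric_state gamma : (Fock R -> Fock R) -> R[i] in
  [/\ gamma = 0 ->
        [/\ is_GNS_triple M phi (@rep_infinity R) (1 : R[i]^o),
            bicommutant (@rep_infinity R @` M) = scalar_operators (Cline R) &
            tail_algebra (@rep_infinity R) = scalar_operators (Cline R)],
      gamma = 1 ->
        [/\ is_GNS_triple M phi (@rep_vacuum R) (vacuum R),
            bicommutant (@rep_vacuum R @` M) = bounded_operators (Fock R) &
            tail_algebra (@rep_vacuum R) = @vacuum_diagonal R] &
      0 < gamma < 1 ->
        [/\ is_GNS_triple M phi (@rep_mixed R) (vector_mixed gamma),
            bicommutant (@rep_mixed R @` M) =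
              opsum_set (bounded_operators (Fock R)) (scalar_operators (Cline R)) &
            tail_algebra (@rep_mixed R) =
              opsum_set (@vacuum_diagonal R) (scalar_operators (Cline R))]].
Proof.
split=> [g0|g1|g01]; rewrite ?g0 ?g1.
- split; [exact: GNS_infinity|exact: bicommutant_Cline|exact: tail_infinity].
- split; [exact: GNS_vacuum|exact: bicommutant_vacuum|exact: tail_vacuum].
- split; [exact: GNS_mixed|exact: bicommutant_mixed|exact: tail_mixed].
Qed.
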